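(* Let $s\ge 1$, $k\ge 1$, $d\ge 1$ be integers and $\lambda>0$, $\delta>0$. Suppose that the data $\{(t_i,y_i)\}_{i\ge 1}$ satisfy Assumptions 1, 2, 3 and 4 (listed in the context), and let $f_n,f_\infty:\Theta\to\mathbb{R}$ be the functionals $$f_n(\mu)=\frac1n\sum_{i=1}^n\min_{1\le j\le k}|y_i-\mu_j(t_i)|^2+\lambda\sum_{j=1}^k\|\nabla^s\mu_j\|_{L^2}^2,$$ $$f_\infty(\mu)=\int_0^1\int_{\mathbb{R}^d}\min_{1\le j\le k}|y-\mu_j(t)|^2\,\phi_Y(y|t)\,\phi_T(t)\,\mathrm{d}y\,\mathrm{d}t+\lambda\sum_{j=1}^k\|\nabla^s\mu_j\|_{L^2}^2,$$ where $\Theta\subset(H^s)^k$ is the set of $k$-tuples of trajectories with minimum separation $\delta$ defined in the context. Let $\{\mu^n\}_{n\in\mathbb{N}}\subset\Theta$ where $\mu^n$ minimizes $f_n$ over $\Theta$. Let $\mu^{n_m}$ be any subsequence that converges weakly in $(H^s)^k$, almost surely, to some $\mu^\infty$. Then, after passing to a further subsequence, $\mu^{n_m}$ converges to $\mu^\infty$ strongly in $(H^s)^k$ and in probability, i.e. $\|\mu^{n_m}-\mu^\infty\|_{(H^s)^k}\to0$ in probability.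
   Context: Function spaces. $H^s$ is the Sobolev space of functions $\mu:[0,1]\to\mathbb{R}^d$ such that $\nabla^i\mu$ is absolutely continuous for $i=0,1,\dots,s-1$ and $\nabla^s\mu\in L^2$, where $\nabla^i$ is the $i$-th derivative in $t$, with its usual Sobolev norm (up to equivalence). $(H^s)^k$ is the $k$-fold product with a product norm. $|\cdot|$ is the Euclidean norm on $\mathbb{R}^d$. For fixed $\delta>0$, $$\Theta=\{\mu=(\mu_1,\dots,\mu_k)\in(H^s)^k:\ |\mu_j(t)-\mu_l(t)|\ge\delta\ \text{ for all } t\in[0,1] \text{ and all } j\ne l\}.$$ Assumptions on the data. All random variables live on a common probability space $(\Omega,\mathcal{F},\mathbb{P})$. Assumption 1: there are $\mu^\dagger=(\mu_1^\dagger,\dots,\mu_k^\dagger)\in(L^\infty)^k$ (functions $[0,1]\to\mathbb{R}^d$) and a probability vector $p=(p_1,\dots,p_k)$ such that $y_i=\mu^\dagger_{\varphi(i)}(t_i)+\epsilon_i$ for every $i\ge1$, where $\varphi(i)\in\{1,\dots,k\}$ with $\mathbb{P}(\varphi(i)=j)=p_j$, $\epsilon_i\in\mathbb{R}^d$ has density $\phi_0$, $t_i\in[0,1]$ has density $\phi_T$; $\varphi(i),\epsilon_i,t_i$ are mutually independent and the triples $(\varphi(i),\epsilon_i,t_i)$, $i\ge1$, are independent and identically distributed; $\phi_0$ and $\phi_T$ are continuous densities with respect to Lebesgue measure on $\mathbb{R}^d$ and $[0,1]$ respectively. Assumption 2: $\phi_0$ is centered (mean zero) and has finite second moments. Assumption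 3: $\phi_0(\epsilon)>0$ for all $\epsilon\in\mathbb{R}^d$. The conditional density of $y$ given $t$ is $\phi_Y(y|t)=\sum_{j=1}^k p_j\,\phi_0(y-\mu_j^\dagger(t))$. Assumption 4: there exist $\alpha<-d-3$ and a constant $c_1$ such that $\sup_{t\in[0,1]}\phi_Y(y|t)\le c_1|y|^\alpha$ (for all $y\in\mathbb{R}^d$, $y\neq0$). *)

(* Defs.v *)
From HB Require Import structures.
From mathcomp Require Import all_boot all_order all_algebra finmap.
From mathcomp Require Import all_classical all_reals all_analysis.

Set Implicit Arguments.
Unset Strict Implicit.
Unset Printing Implicit Defensive.

Import Order.TTheory GRing.Theory Num.Theory.
Import numFieldNormedType.Exports.

Local Open Scope classical_set_scope.
Local Open Scope ring_scope.

HB.instance Definition _ (k : nat) := isPointed.Build 'I_k.+1 ord0.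

HB.instance Definition _ (k : nat) :=
  @isMeasurable.Build default_measure_display 'I_k.+1 discrete_measurable
    discrete_measurable0 discrete_measurableC discrete_measurableU.

Section measurable_rowvector.
Context {d} {T : measurableType d} {n : nat}.

Let coors : 'I_n -> 'rV[T]_n -> T := fun i x => x ord0 i.

Let row_set0 : g_sigma_preimage coors set0.
Proof. exact: sigma_algebra0. Qed.

Let row_setC A : g_sigma_preimage coors A -> g_sigma_preimage coors (~` A).
Proof. exact: sigma_algebraC. Qed.

Let row_bigcup (F : _^nat) : (forall i, g_sigma_preimage coors (F i)) ->
  g_sigma_preimage coors (\bigcup_i (F i)).
Proof. exact: sigma_algebra_bigcup. Qed.

(* Product sigma-algebra; for T = R it is the Borel sigma-algebra of R^n. *)
HB.instance Definition _ := @isMeasurable.Build (measure_tuple_display d)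
  'rV[T]_n (g_sigma_preimage coors) row_set0 row_setC row_bigcup.

End measurable_rowvector.

Lemma measurable_coord d (T : measurableType d) n (i : 'I_n) :
  measurable_fun [set: 'rV[T]_n] (fun v : 'rV[T]_n => v ord0 i).
Proof.
move=> _ Y mY; rewrite setTI; apply: sub_sigma_algebra => /=.
rewrite -bigcup_seq/=; exists i => /=; first by rewrite mem_index_enum.
by exists Y => //; rewrite setTI.
Qed.

Lemma measurable_rowP d1 d2 (T1 : measurableType d1) (T2 : measurableType d2) n
    (D : set T1) (f : T1 -> 'rV[T2]_n) : measurable D ->
  measurable_fun D f <->
  forall i, measurable_fun D (fun x => f x ord0 i).
Proof.
move=> mD; split=> [mf i|mf].
  exact: (measurableT_comp (@measurable_coord _ T2 n i) mf).
move=> _ /= B mB.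
pose G := [set A : set 'rV[T2]_n | measurable (D `&` f @^-1` A)].
have sG : sigma_algebra setT G.
  split.
  - by rewrite /G/= preimage_set0 setI0; exact: measurable0.
  - move=> A GA; rewrite /G/= setTD preimage_setC -setDE.
    have -> : D `\` f @^-1` A = D `\` (D `&` f @^-1` A).
      by rewrite setDIr setDv set0U.
    exact: measurableD.
  - move=> F GF; rewrite /G/= preimage_bigcup setI_bigcupr.
    exact: bigcupT_measurable.
apply: (smallest_sub sG _ mB) => A.
rewrite -bigcup_seq/= => -[i _ [C mC <-]]; rewrite /G/= setTI.
exact: mf.
Qed.

Section lebesgue_rowvector.
Variable R : realType.

Definition row_cons n (xv : measurableTypeR R * 'rV[R]_n) : 'rV[R]_n.+1 :=
  \row_i (if unlift ord0 i is Some j then xv.2 ord0 j else xv.1).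

Let row_uncons n (v : 'rV[R]_n.+1) : measurableTypeR R * 'rV[R]_n :=
  (v ord0 ord0, \row_i v ord0 (lift ord0 i)).

Lemma measurable_row_cons n : measurable_fun setT (@row_cons n).
Proof.
apply/measurable_rowP => // i.
under eq_fun do rewrite mxE.
case: unliftP => [j _|_]; last exact: measurable_fst.
exact: (measurableT_comp (@measurable_coord _ R n j) measurable_snd).
Qed.

Let measurable_row_uncons n : measurable_fun setT (@row_uncons n).
Proof.
apply/measurable_fun_pairP; split; first exact: measurable_coord.
apply/measurable_rowP => // i.
under eq_fun do rewrite /= mxE; exact: measurable_coord.
Qed.

Let row_consK n : cancel (@row_cons n) (@row_uncons n).
Proof.
move=> [x v]; rewrite /row_uncons /row_cons mxE unlift_none/=; congr pair.
by apply/rowP => i; rewrite !mxE liftK.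
Qed.

Section step.
Variables (n : nat) (nu : {sigma_finite_measure set 'rV[R]_n -> \bar R}).

Definition lebesgue_cons : set 'rV[R]_n.+1 -> \bar R :=
  pushforward (@lebesgue_measure R \x nu)%E (@row_cons n).

(* The library's sigma-finiteness instance for products is not inferred here. *)
Let prod_sigma_finite :
  sigma_finite setT (@lebesgue_measure R \x nu)%E.
Proof.
have /sigma_finiteP[F [TF ndF Foo]] := sigma_finiteT (@lebesgue_measure R).
have /sigma_finiteP[G [TG ndG Goo]] := sigma_finiteT nu.
exists (fun n => F n `*` G n).
  rewrite -setXTT TF TG predeqE => -[x y]; split.
    move=> [/= [i _ Fix] [j _ Gjy]]; exists (maxn i j) => //; split.
    - by move: x Fix; exact/subsetPset/ndF/leq_maxl.
    - by move: y Gjy; exact/subsetPset/ndG/leq_maxr.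
  by move=> [i _ []/= ? ?]; split; exists i.
move=> i; have [? ?] := Foo i; have [? ?] := Goo i.
split; first exact: measurableX.
by rewrite product_measure1E// lte_mul_pinfty// ge0_fin_numE.
Qed.

Let m : {measure set _ -> \bar R} :=
  measure_function_pushforward__canonical__measure_function_Measure
    (@lebesgue_measure R \x nu)%E (@measurable_row_cons n).

HB.instance Definition _ := isMeasure.Build _ _ _ lebesgue_cons
  (measure0 m) (measure_ge0 m) (@measure_semi_sigma_additive _ _ _ m).

Let lebesgue_cons_sigma_finite : sigma_finite setT lebesgue_cons.
Proof.
have [F FT Foo] := prod_sigma_finite.
exists (fun i => @row_uncons n @^-1` F i).
  by rewrite -preimage_bigcup -FT preimage_setT.
move=> i; have [mF Fi] := Foo i; split.
  by rewrite -[X in measurable X]setTI; exact: measurable_row_uncons.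
rewrite /lebesgue_cons /pushforward.
suff -> : @row_cons n @^-1` (@row_uncons n @^-1` F i) = F i by [].
by apply/seteqP; split=> xv /=; rewrite row_consK.
Qed.

HB.instance Definition _ :=
  Measure_isSigmaFinite.Build _ _ _ lebesgue_cons lebesgue_cons_sigma_finite.

End step.

(* Lebesgue measure on R^n; see lebesgue_row_box. *)
Fixpoint lebesgue_row n : {sigma_finite_measure set 'rV[R]_n -> \bar R} :=
  match n with
  | 0 => \d_(0 : 'rV[R]_0)
  | m.+1 => lebesgue_cons (lebesgue_row m)
  end.

End lebesgue_rowvector.

Lemma lebesgue_row_box (R : realType) n (A : 'I_n -> set R) :
  (forall i, measurable (A i)) ->
  lebesgue_row R n [set v | forall i, A i (v ord0 i)] =
  (\prod_(i < n) lebesgue_measure (A i))%E.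
Proof.
elim: n A => [|n IH] A mA.
  by rewrite big_ord0 /= diracE mem_set//= => -[].
rewrite big_ord_recl -IH; last by move=> i; exact: mA.
rewrite [LHS]/= /lebesgue_cons /pushforward.
rewrite -(@product_measure1E _ _ _ _ R (@lebesgue_measure R) (lebesgue_row R n)).
- congr (_ _); apply/seteqP; split=> -[x v] /=.
    move=> h; split=> [|i]; first by have := h ord0; rewrite mxE unlift_none.
    by have := h (lift ord0 i); rewrite mxE liftK.
  move=> [Ax Av] i; rewrite mxE; case: unliftP => [j ->|->] //.
- exact: mA.
- rewrite [X in measurable X](_ : _ =
    \bigcap_(i in [set: 'I_n]) ((fun v : 'rV[R]_n => v ord0 i) @^-1` A (lift ord0 i))).
    apply: fin_bigcap_measurable => // i _.
    rewrite -[X in measurable X]setTI.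
    exact: (@measurable_coord _ R n i measurableT _ (mA _)).
  by apply/seteqP; split=> v /= h i; [move=> _; exact: h|exact: (h i I)].
Qed.

Section sobolev.
Variables (R : realType) (d : nat).

Definition enorm (v : 'rV[R]_d) : R := Num.sqrt (\sum_(i < d) v ord0 i ^+ 2).

(* Curves [0,1] -> R^d are represented by total functions on R; only their
   values on [0,1] are ever used. *)
Implicit Types f g : R -> 'rV[R]_d.

Definition abs_continuous01 f : Prop :=
  forall e : R, 0 < e -> exists2 h : R, 0 < h &
    forall (n : nat) (a b : 'I_n -> R),
      (forall i, 0 <= a i /\ a i <= b i /\ b i <= 1) ->
      trivIset [set: 'I_n] (fun i => `]a i, b i[%classic) ->
      \sum_(i < n) (b i - a i) < h ->
      \sum_(i < n) enorm (f (b i) - f (a i)) < e.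

Definition diff_quot f (t h : R) : 'rV[R]_d := h^-1 *: (f (t + h) - f t).

(* Increments h != 0 tending to 0 with t + h in [0,1]: the derivative is
   one-sided at the endpoints. *)
Definition increments01 (t : R) : set_system R :=
  within [set h | 0 <= t + h <= 1] 0^'.

Definition derivable01 f (t : R) : Prop :=
  cvg (diff_quot f t h @[h --> increments01 t]).

Definition deriv01 f (t : R) : 'rV[R]_d :=
  lim (diff_quot f t h @[h --> increments01 t]).

Definition nabla (i : nat) f : R -> 'rV[R]_d := iter i deriv01 f.

Definition square_integrable01 f : Prop :=
  measurable_fun (`[0, 1] : set R) f /\
  (\int[@lebesgue_measure R]_(t in `[0%R, 1%R]) (enorm (f t) ^+ 2)%:E < +oo)%E.

Definition sqL2norm f : R :=
  \int[lebesgue_measure]_(t in `[0, 1]) (enorm (f t) ^+ 2).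

(* The derivatives of order i < s exist on all of [0,1], the one of order s
   almost everywhere. *)
Record sobolev (s : nat) f : Prop := Sobolev {
  sobolev_derivable : forall i, (i.+1 < s)%N ->
    forall t, 0 <= t <= 1 -> derivable01 (nabla i f) t ;
  sobolev_ae_derivable : forall i, i.+1 = s ->
    {ae lebesgue_measure, forall t, 0 <= t <= 1 -> derivable01 (nabla i f) t} ;
  sobolev_ac : forall i, (i < s)%N -> abs_continuous01 (nabla i f) ;
  sobolev_L2 : square_integrable01 (nabla s f) }.

End sobolev.

Section tracks.
Variables (R : realType) (d k s : nat).

(* k.+1 trajectories, so that there is at least one of them. *)
Definition tracks := 'I_k.+1 -> R -> 'rV[R]_d.

Implicit Types m : tracks.

Definition sobolev_tracks m : Prop := forall j, sobolev s (m j).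

Definition sobolev_norm m : R :=
  Num.sqrt (\sum_(j < k.+1) \sum_(i < s.+1) sqL2norm (nabla i (m j))).

(* The topological dual of (H^s)^k, with functionals extended arbitrarily
   outside (H^s)^k. *)
Record bounded_functional (L : tracks -> R) : Prop := BoundedFunctional {
  functional_linear : forall (a : R) m1 m2,
    sobolev_tracks m1 -> sobolev_tracks m2 ->
    L (fun j t => a *: m1 j t + m2 j t) = a * L m1 + L m2 ;
  functional_bounded : exists C : R, forall m, sobolev_tracks m ->
    `|L m| <= C * sobolev_norm m }.

Definition weak_cvg (m_ : nat -> tracks) m : Prop :=
  sobolev_tracks m /\
  forall L, bounded_functional L -> L (m_ n) @[n --> \oo] --> L m.

Definition Theta (delta : R) m : Prop :=
  sobolev_tracks m /\
  forall t, 0 <= t <= 1 -> forall j l, j != l ->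
    delta <= enorm (m j t - m l t).

Definition min_sqdist m (t : R) (y : 'rV[R]_d) : R :=
  \big[Num.min/enorm (y - m ord0 t) ^+ 2]_(j < k.+1) enorm (y - m j t) ^+ 2.

Definition regularizer (lambda : R) m : R :=
  lambda * \sum_(j < k.+1) sqL2norm (nabla s (m j)).

(* The data are numbered from 0. *)
Definition f_n (lambda : R) (t : nat -> R) (y : nat -> 'rV[R]_d) (n : nat) m : R :=
  n%:R^-1 * (\sum_(i < n) min_sqdist m (t i) (y i)) + regularizer lambda m.

Definition f_infty (lambda : R) (phiY : 'rV[R]_d -> R -> R) (phiT : R -> R) m : R :=
  \int[lebesgue_measure]_(t in `[0, 1])
    (\int[lebesgue_row R d]_y (min_sqdist m t y * phiY y t * phiT t))
  + regularizer lambda m.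

Definition minimizes (A : tracks -> Prop) (F : tracks -> R) m : Prop :=
  A m /\ forall m', A m' -> F m <= F m'.

End tracks.

Section probability.
Context {disp : measure_display} {Omega : measurableType disp} {R : realType}.
Variable P : probability Omega R.

Definition has_density d (T : measurableType d) (X : Omega -> T)
    (nu : set T -> \bar R) (D : set T) (phi : T -> R) : Prop :=
  [/\ measurable_fun D phi, forall x, D x -> 0 <= phi x &
      forall A, measurable A ->
        P (X @^-1` A) = (\int[nu]_(x in D `&` A) (phi x)%:E)%E].

Definition independent3 d1 d2 d3 (T1 : measurableType d1)
    (T2 : measurableType d2) (T3 : measurableType d3)
    (X1 : Omega -> T1) (X2 : Omega -> T2) (X3 : Omega -> T3) : Prop :=
  forall A1 A2 A3, measurable A1 -> measurable A2 -> measurable A3 ->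
    P (X1 @^-1` A1 `&` X2 @^-1` A2 `&` X3 @^-1` A3) =
    (P (X1 @^-1` A1) * P (X2 @^-1` A2) * P (X3 @^-1` A3))%E.

Definition independent_seq d (T : measurableType d) (X : nat -> Omega -> T) : Prop :=
  forall (J : {fset nat}) (A : nat -> set T), (forall i, measurable (A i)) ->
    P (\bigcap_(i in [set` J]) X i @^-1` A i) =
    (\prod_(i <- J) P (X i @^-1` A i))%E.

Definition identically_distributed d (T : measurableType d)
    (X : nat -> Omega -> T) : Prop :=
  forall i j A, measurable A -> P (X i @^-1` A) = P (X j @^-1` A).

(* P^* is the outer probability, equal to P on measurable sets; it avoids
   requiring the limit to be measurable. *)
Definition cvg_in_probability0 (X : nat -> Omega -> R) : Prop :=
  forall e : R, 0 < e ->
    (P^*)%mu [set w | e <= `|X n w|] @[n --> \oo] --> 0%E.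

(* A random element of the separable Hilbert space (H^s)^k, whose Borel
   sigma-algebra is generated by the evaluations. *)
Definition random_tracks d k (m : Omega -> tracks R d k) : Prop :=
  forall j t, 0 <= t <= 1 -> measurable_fun setT (fun w => m w j t).

End probability.

Section assumptions.
Context {disp : measure_display} {Omega : measurableType disp} {R : realType}.
Variables (P : probability Omega R) (d k : nat).
Variables (mudag : tracks R d k) (p : 'I_k.+1 -> R).
Variables (phi0 : 'rV[R]_d -> R) (phiT : R -> R).
Variables (phi : nat -> {RV P >-> 'I_k.+1}) (eps : nat -> {RV P >-> 'rV[R]_d}).
Variables (t : nat -> {RV P >-> R}) (y : nat -> {RV P >-> 'rV[R]_d}).

Definition Linfty01 (f : R -> 'rV[R]_d) : Prop :=
  measurable_fun (`[0, 1] : set R) f /\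
  exists M : R,
    {ae lebesgue_measure, forall x : R, 0 <= x <= 1 -> enorm (f x) <= M}.

Record assumption1 : Prop := Assumption1 {
  a1_Linfty : forall j, Linfty01 (mudag j) ;
  a1_p : (forall j, 0 <= p j) /\ \sum_(j < k.+1) p j = 1 ;
  a1_model : forall i,
    {ae P, forall w, y i w = mudag (phi i w) (t i w) + eps i w} ;
  a1_phi : forall i j, P (phi i @^-1` [set j]) = (p j)%:E ;
  a1_t01 : forall i w, 0 <= t i w <= 1 ;
  a1_eps : forall i, has_density P (eps i) (lebesgue_row R d) setT phi0 ;
  a1_t : forall i, has_density P (t i) lebesgue_measure `[0, 1] phiT ;
  a1_independent : forall i, independent3 P (phi i) (eps i) (t i) ;
  a1_iid_indep : independent_seq P (fun i w => (phi i w, eps i w, t i w)) ;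
  a1_iid_law :
    identically_distributed P (fun i w => (phi i w, eps i w, t i w)) ;
  a1_phi0_continuous : continuous phi0 ;
  a1_phiT_continuous : {within `[0, 1], continuous phiT} }.

Definition assumption2 : Prop :=
  (forall i : 'I_d, \int[lebesgue_row R d]_x (x ord0 i * phi0 x) = 0) /\
  (\int[lebesgue_row R d]_x (enorm x ^+ 2 * phi0 x)%:E < +oo)%E.

Definition assumption3 : Prop := forall x, 0 < phi0 x.

Definition phiY (z : 'rV[R]_d) (x : R) : R :=
  \sum_(j < k.+1) p j * phi0 (z - mudag j x).

Definition assumption4 : Prop :=
  exists alpha c1 : R, alpha < - d%:R - 3 /\
    forall z : 'rV[R]_d, z != 0 ->
      (ereal_sup [set (phiY z x)%:E | x in `[0%R, 1%R]] <=
       (c1 * enorm z `^ alpha)%:E)%E.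

End assumptions.

(* Main.v *)
Require Import Defs.
From HB Require Import structures.
From mathcomp Require Import all_boot all_order all_algebra.
From mathcomp Require Import all_classical all_reals all_analysis.
From mathcomp Require Import measurable_realfun ring lra.

(** Almost sure weak convergence of the minimizers becomes strong convergence
    because minimality forces their energies to converge as well. The data enter
    through the tightness of A_n, the mean of |y_i|^2 over the first n
    observations: as y_i is an essentially bounded function of (phi(i), t_i) plus
    a noise term with finite second moment, E A_n is bounded
    ([second_moment_bounded]), hence A_n is tight by Markov's inequality
    ([mean_sq_tight]).

    The core is an argument for one fixed outcome ([minimizers_strong_cvg]). Write
    mu_l for the minimizers, mu for their weak limit, J for the sum of the squared
    L^2 norms of the s-th derivatives, and consider only the indices l at which
    A_n <= M. Comparing mu_l with constant curves that are delta apart bounds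
    J(mu_l), so the mu_l are equi-Hoelder, and evaluations being weakly
    continuous, mu_l tends to mu uniformly on [0,1]
    ([bounded_energy_uniform_cvg]). The limit again belongs to Theta, so mu is
    itself a competitor; as the data terms of mu_l and mu differ little, the
    comparison gives limsup J(mu_l) <= J(mu). The parallelogram identity
    J(mu_l - mu) = 2 J(mu_l) + 2 J(mu) - J(mu_l + mu), together with lower
    semicontinuity of J applied to mu_l + mu, which tends to 2 mu, then shows that
    J(mu_l - mu) tends to 0 ([energy_limsup_strong_cvg]). The derivatives of
    lower order are controlled by J and by their values at 0.

    Measurability in the outcome and lower semicontinuity of J come from the same
    fact: J is the limit of discrete energies that involve finitely many values
    of the derivative of order s-1 and never exceed J
    ([discrete_energy_cvg], [discrete_energy_le]). Their convergence rests on
    Fatou's lemma and on the fundamental theorem of calculus for absolutely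
    continuous functions ([ac_primitive]), by which everything reduces to real
    functions of the form g(b) - g(a) = \int_a^b v with v square integrable.

    Finally, for every M, the events on which A_n <= M but mu_l is still far from
    mu are measurable and almost every outcome lies in finitely many of them, so
    their probabilities vanish; adding the small probability of A_n >= M gives
    convergence in (outer) probability ([tight_cvg_in_probability0]). *)

Set Implicit Arguments.
Unset Strict Implicit.
Unset Printing Implicit Defensive.

Import Order.TTheory GRing.Theory Num.Theory.
Import numFieldNormedType.Exports.
Import HBNNSimple.

Local Open Scope classical_set_scope.
Local Open Scope ring_scope.

(** * Constancy of absolutely continuous functions with null derivative *)

Section constancy.
Variable R : realType.

Lemma lebesgue_aeS (P Q : R -> Prop) : (forall x, P x -> Q x) ->
  {ae @lebesgue_measure R, forall x, P x} -> {ae @lebesgue_measure R, forall x, Q x}.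
Proof.
by move=> PQ; apply: filterS => //; exact: (ae_filter_ringOfSetsType (@lebesgue_measure R)).
Qed.

Lemma lebesgue_aeS2 (P Q S : R -> Prop) : (forall x, P x -> Q x -> S x) ->
  {ae @lebesgue_measure R, forall x, P x} -> {ae @lebesgue_measure R, forall x, Q x} ->
  {ae @lebesgue_measure R, forall x, S x}.
Proof.
by move=> PQ; apply: filterS2 => //; exact: (ae_filter_ringOfSetsType (@lebesgue_measure R)).
Qed.

(** Induction along an interval: the supremum of the points up to which the
    property is known cannot be smaller than [b], since the step around that
    supremum carries the property from a point on its left to one on its right.
    Only the passage from some nearby [x <= c] to [x' >= c] has to be checked,
    which is what differentiability at [c] controls. *)
Lemma interval_induction (P : R -> Prop) (b : R) : 0 <= b -> P 0 ->
  (forall c, 0 <= c <= b -> exists2 r : R, 0 < r & forall x x',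
     0 <= x -> x <= c -> c <= x' -> x' <= b -> c - x < r -> x' - c < r ->
     P x -> P x') ->
  P b.
Proof.
move=> b0 P0 step; pose S := [set x | 0 <= x <= b /\ P x].
have S0 : S 0 by split=> //; rewrite lexx.
have ubS : ubound S b by move=> x [/andP[]].
have hS : has_sup S by split; [exists 0|exists b].
pose c := sup S.
have c0 : 0 <= c by apply: ub_le_sup S0; exists b.
have cb : c <= b by apply: ge_sup ubS; exists 0.
have [|r r0 hr] := step c; first by rewrite c0.
have [x [/andP[x0 xb] Px] cx] := sup_adherent r0 hS.
have xc : x <= c by apply: ub_le_sup; [exists b|split=> //; rewrite x0].
have Px' : P (Num.min b (c + r / 2)).
  apply: (hr x) Px => //.
  - by rewrite le_min cb lerDl divr_ge0 ?ltW.
  - by rewrite ge_min lexx.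
  - by rewrite -/c in cx; lra.
  - have : Num.min b (c + r / 2) <= c + r / 2 by rewrite ge_min lexx orbT.
    by lra.
have [bc|bc] := leP b (c + r / 2); first by move: Px'; rewrite min_l.
move: Px'; rewrite min_r ?ltW// => Px'.
have : c + r / 2 <= c.
  apply: ub_le_sup; first by exists b.
  by split=> //; rewrite (ltW bc) addr_ge0// divr_ge0 ?ltW.
by have := r0; lra.
Qed.

Definition absolutely_continuous (g : R -> R) : Prop :=
  forall e : R, 0 < e -> exists2 h : R, 0 < h &
    forall (n : nat) (a b : 'I_n -> R),
      (forall i, 0 <= a i /\ a i <= b i /\ b i <= 1) ->
      trivIset [set: 'I_n] (fun i => `]a i, b i[%classic) ->
      \sum_(i < n) (b i - a i) < h ->
      \sum_(i < n) `|g (b i) - g (a i)| < e.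

(** Differentiability at [t] relative to [0,1], with derivative [l]; one-sided at
    the endpoints. *)
Definition slope (g : R -> R) (t l : R) : Prop :=
  forall e : R, 0 < e -> exists2 r : R, 0 < r &
    forall x, 0 <= x <= 1 -> `|x - t| < r ->
      `|g x - g t - l * (x - t)| <= e * `|x - t|.

Local Notation mu := (@lebesgue_measure R).

Definition length_below (U : set R) (x : R) : R := fine (mu (U `&` `[0, x]%classic)).

Section length_below.
Variables (U : set R) (h : R).
Hypothesis mU : measurable U.
Hypothesis muU : (mu U < h%:E)%E.

Let finU (x : R) : mu (U `&` `[0, x]%classic) \is a fin_num.
Proof.
rewrite ge0_fin_numE// (le_lt_trans _ (lt_trans muU (ltry _)))// le_measure// inE//.
exact: measurableI.
Qed.

Lemma length_below_ge0 x : 0 <= length_below U x.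
Proof. by rewrite fine_ge0. Qed.

Lemma length_below_lt x : length_below U x < h.
Proof.
rewrite -lte_fin fineK// (le_lt_trans _ muU)// le_measure// inE//.
exact: measurableI.
Qed.

Lemma length_below_mono x x' : x <= x' -> length_below U x <= length_below U x'.
Proof.
move=> xx'; rewrite fine_le// le_measure ?inE//; try exact: measurableI.
by apply: setIS; apply: subset_itvl; rewrite bnd_simp.
Qed.

Lemma length_below_add x x' : 0 <= x -> x <= x' -> `[x, x']%classic `<=` U ->
  length_below U x + (x' - x) <= length_below U x'.
Proof.
move=> x0; rewrite le_eqVlt => /predU1P[->|xx'] sU; first by rewrite subrr addr0.
have muB : mu `]x, x']%classic = (x' - x)%:E by rewrite lebesgue_measure_itv/= lte_fin xx'.
have muAB : mu (U `&` `[0, x]%classic `|` `]x, x']%classic) =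
    (mu (U `&` `[0%R, x]%classic) + mu `]x, x']%classic)%E.
  apply: measureU => //; first exact: measurableI.
  by apply/seteqP; split=> // y [[_]] /=; rewrite !in_itv/= => /andP[_ +] /andP[]; lra.
rewrite -lee_fin EFinD -muB !fineK// -muAB le_measure ?inE//.
- by apply: measurableU => //; exact: measurableI.
- exact: measurableI.
- move=> y [[Uy]|] /=; rewrite !in_itv/= => /andP[y1 y2].
    by split=> //; lra.
  by split; [apply: sU; rewrite /= in_itv/=; lra|lra].
Qed.

End length_below.

(** The exceptional null set is covered by an open set [U] of small length.
    Running along [0,b] one collects a finite family of disjoint intervals in
    [U], over which absolute continuity bounds the variation of [G], while
    outside the exceptional set the slope 0 allows an increment of at most [e/2]
    times the length. The total length of the family is kept below that of the
    part of [U] already passed. *)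
Lemma ac_slope0_constant (G : R -> R) : absolutely_continuous G ->
  {ae mu, forall t, 0 <= t <= 1 -> slope G t 0} ->
  forall b, 0 <= b <= 1 -> G b = G 0.
Proof.
move=> acG [N [mN muN0 badN]] b /andP[b0 b1].
apply/eqP; rewrite -subr_eq0 -normr_le0; apply/ler_addgt0Pr => e e0; rewrite add0r.
have [h h0 hac] := acG _ (divr_gt0 e0 (ltr0n R 2)).
have [|U [oU NU UN]] := @lebesgue_regularity_outer R N h mN _ h0.
  by change (mu N < +oo)%E; rewrite muN0 ltry.
have {}UN : (mu (U `\` N) < h%:E)%E by exact: UN.
have mU : measurable U by exact: open_measurable.
have muU : (mu U < h%:E)%E.
  suff -> : mu U = (mu N + mu (U `\` N))%E by rewrite muN0 add0e.
  rewrite -[in LHS](setDUK NU); apply: measureU => //; first exact: measurableD.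
  by rewrite setDIK.
pose Q x := exists n (a c : 'I_n -> R), [/\
  (forall i, 0 <= a i /\ a i <= c i /\ c i <= x),
  trivIset [set: 'I_n] (fun i => `]a i, c i[%classic),
  \sum_(i < n) (c i - a i) <= length_below U x &
  `|G x - G 0| <= e / 2 * x + \sum_(i < n) `|G (c i) - G (a i)|].
suff [n [a [c [ac tI sm GG]]]] : Q b.
  apply: le_trans GG _.
  have : \sum_(i < n) `|G (c i) - G (a i)| < e / 2.
    apply: hac => //; last exact: le_lt_trans sm (length_below_lt mU muU b).
    by move=> i; have [? [? ?]] := ac i; split=> //; split=> //; lra.
  have : e / 2 * b <= e / 2 by rewrite ler_piMr// divr_ge0// ltW.
  by lra.
have length_mono := length_below_mono mU muU.
have length_add := length_below_add mU muU.
apply: interval_induction => //.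
  exists 0%N, (fun=> 0), (fun=> 0); split => //.
  - by case.
  - by rewrite big_ord0 length_below_ge0.
  - by rewrite subrr normr0 mulr0 big_ord0 addr0.
move=> c /andP[c0 cb].
have [Nc|nNc] := EM (N c).
- have /nbhs_ballP[r /= r0 rU] : nbhs c U by exact/(open_nbhs_nbhs (conj oU (NU _ Nc))).
  exists r => // x x' x0 xc cx' x'b cx x'c [n [a [d [ad tI sm GG]]]].
  have sU : `[x, x']%classic `<=` U.
    move=> z /=; rewrite in_itv/= => /andP[xz zx']; apply: rU.
    by rewrite /ball/= ltr_distl; lra.
  (* The interval from x to x' joins the family. *)
  exists n.+1, (fun i => if unlift ord0 i is Some j then a j else x),
    (fun i => if unlift ord0 i is Some j then d j else x'); split.
  + move=> i; case: unliftP => [j _|_]; last by lra.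
    by have := ad j; lra.
  + apply/trivIsetP => i j _ _.
    case: unliftP => [i' ->|->]; case: unliftP => [j' ->|->].
    * move=> ij; move/trivIsetP : tI => /(_ i' j' I I); apply.
      by apply: contra_neq ij => ->.
    * move=> _; apply/seteqP; split=> // z [] /=; rewrite !in_itv/=.
      move=> /andP[_ zd] /andP[xz _]; have [_ [_ dx]] := ad i'.
      by have := lt_le_trans (lt_trans xz zd) dx; rewrite ltxx.
    * move=> _; apply/seteqP; split=> // z [] /=; rewrite !in_itv/=.
      move=> /andP[xz _] /andP[_ zd]; have [_ [_ dx]] := ad j'.
      by have := lt_le_trans (lt_trans xz zd) dx; rewrite ltxx.
    * by rewrite eqxx.
  + rewrite big_ord_recl/= unlift_none; under eq_bigr do rewrite liftK.
    have xx' : x <= x' by lra.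
    by rewrite addrC (le_trans _ (length_add _ _ x0 xx' sU))// lerD2r.
  + rewrite big_ord_recl/= unlift_none; under eq_bigr do rewrite liftK.
    have -> : G x' - G 0 = (G x' - G x) + (G x - G 0) by ring.
    rewrite (le_trans (ler_normD _ _))// addrCA lerD2l (le_trans GG)// lerD2r.
    by apply: ler_wpM2l; lra.
- have sc : slope G c 0.
    by have /contrapT /= := contra_not (badN c) nNc; apply; lra.
  have [r r0 hr] := sc _ (divr_gt0 e0 (ltr0n R 2)).
  exists r => // x x' x0 xc cx' x'b cx x'c [n [a [d [ad tI sm GG]]]].
  have xx' : x <= x' by lra.
  exists n, a, d; split => //.
  + by move=> i; have [? [? ?]] := ad i; split=> //; split=> //; exact: le_trans xx'.
  + exact: le_trans sm (length_mono _ _ xx').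
  + have h1 : `|G x' - G c| <= e / 2 * (x' - c).
      by have := hr x'; rewrite mul0r subr0 ger0_norm ?subr_ge0//; apply=> //; lra.
    have h2 : `|G x - G c| <= e / 2 * (c - x).
      by have := hr x; rewrite mul0r subr0 (distrC x) ger0_norm ?subr_ge0//; apply=> //; lra.
    have -> : G x' - G 0 = (G x' - G c) + (G c - G x) + (G x - G 0) by ring.
    rewrite (le_trans (ler_normD _ _))// (le_trans (lerD (ler_normD _ _) GG))//.
    by rewrite (distrC (G c)); lra.
Qed.

End constancy.

(** * Primitives of square integrable functions *)

Section primitive.
Variable R : realType.
Local Notation mu := (@lebesgue_measure R).
Implicit Types (g v : R -> R).

Lemma integrable_cst_itv (a b c : R) : mu.-integrable `[a, b]%classic (EFin \o cst c).
Proof.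
apply/integrableP; split; first exact/measurable_EFinP.
rewrite (eq_integral (cst `|c|%:E))// integral_cst//.
apply: lte_mul_pinfty => //; change (mu `[a, b]%classic < +oo)%E.
by rewrite lebesgue_measure_itv/=; case: ifP => _; rewrite ?ltry.
Qed.

Lemma Rintegral_cst_itv (a b c : R) : a <= b -> \int[mu]_(_ in `[a, b]%classic) c = c * (b - a).
Proof.
move=> ab; rewrite Rintegral_cst//; congr (_ * _).
change (fine (mu `[a, b]%classic) = b - a).
move: ab; rewrite lebesgue_measure_itv/= lte_fin le_eqVlt => /predU1P[->|->] //.
by rewrite ltxx subrr.
Qed.

(** [v] is the weak derivative of [g] on [0,1], and is square integrable. The
    integral form is stable under linear combinations without any discussion of
    exceptional points. *)
Record primitive (g v : R -> R) : Prop := Primitive {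
  primitive_measurable : measurable_fun (`[0, 1]%classic : set R) v ;
  primitive_sq_integrable : mu.-integrable (`[0, 1]%classic : set R) (fun x => (v x ^+ 2)%:E) ;
  primitive_increment : forall a b, 0 <= a -> a <= b -> b <= 1 ->
    g b - g a = \int[mu]_(x in `[a, b]%classic) v x }.

Definition energy v : R := \int[mu]_(x in `[0, 1]%classic) v x ^+ 2.

Lemma sub_itv01 (a b : R) : 0 <= a -> b <= 1 -> `[a, b]%classic `<=` `[0, 1]%classic.
Proof. by move=> a0 b1 x /=; rewrite !in_itv/=; lra. Qed.

Lemma sq_integrable_integrable v (a b : R) :
  measurable_fun `[a, b]%classic v ->
  mu.-integrable `[a, b]%classic (fun x => (v x ^+ 2)%:E) ->
  mu.-integrable `[a, b]%classic (EFin \o v).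
Proof.
move=> mv iv.
apply: (@le_integrable _ _ _ mu _ _ (EFin \o v) (fun x => (v x ^+ 2)%:E + (EFin \o cst 1%R) x)%E) => //.
- exact/measurable_EFinP.
- move=> x Dx; rewrite /= lee_fin [leRHS]ger0_norm ?addr_ge0 ?sqr_ge0//.
  have := sqr_ge0 (`|v x| - 1); have := sqr_ge0 (v x).
  by rewrite sqrrB -normrX (ger0_norm (sqr_ge0 _)); lra.
- by apply: integrableD => //; exact: integrable_cst_itv.
Qed.

Lemma primitive_integrable g v : primitive g v ->
  mu.-integrable `[0, 1]%classic (EFin \o v).
Proof.
by move=> [mv iv _]; exact: sq_integrable_integrable.
Qed.

Lemma energy_ge0 v : 0 <= energy v.
Proof. by apply: Rintegral_ge0 => x _; exact: sqr_ge0. Qed.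

(** Expanding the integral of [(v - c)^2 >= 0] with [c] the mean of [v]. *)
Lemma cauchy_schwarz_itv v (a b : R) : a <= b -> measurable_fun `[a, b]%classic v ->
  mu.-integrable `[a, b]%classic (fun x => (v x ^+ 2)%:E) ->
  (\int[mu]_(x in `[a, b]%classic) v x) ^+ 2 <=
  (b - a) * \int[mu]_(x in `[a, b]%classic) v x ^+ 2.
Proof.
rewrite le_eqVlt => /predU1P[<-|ab] mv iv.
  by rewrite set_itv1 !Rintegral_set1 expr0n/= subrr mul0r.
have iv1 : mu.-integrable `[a, b]%classic (EFin \o v).
  exact: sq_integrable_integrable.
set I := \int[mu]_(x in _) v x; set S := \int[mu]_(x in _) v x ^+ 2.
pose c := I / (b - a).
have : 0 <= \int[mu]_(x in `[a, b]%classic) ((v x ^+ 2 - (2 * c) * v x) + c ^+ 2).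
  by apply: Rintegral_ge0 => x _; have := sqr_ge0 (v x - c); rewrite sqrrB; lra.
have icv : mu.-integrable `[a, b]%classic (EFin \o (fun x => 2 * c * v x)).
  exact: (integrableZl _ (2 * c) iv1).
rewrite RintegralD//; [|exact: (integrableB _ iv icv)|exact: integrable_cst_itv].
rewrite RintegralB// RintegralZl// (Rintegral_cst_itv _ (ltW ab)) -/I -/S.
have ba : 0 < b - a by lra.
have cI : c * (b - a) = I by rewrite /c divfK// gt_eqF.
move=> h; have : 0 <= (b - a) * (S - 2 * c * I + c ^+ 2 * (b - a)) by rewrite mulr_ge0// ltW.
by rewrite -cI; nra.
Qed.

Lemma primitive_holder g v (a b : R) : primitive g v -> 0 <= a -> a <= b -> b <= 1 ->
  (g b - g a) ^+ 2 <= (b - a) * energy v.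
Proof.
move=> [mv iv gv] a0 ab b1; rewrite gv//.
have sub := sub_itv01 a0 b1.
have iv' : mu.-integrable `[a, b]%classic (fun x => (v x ^+ 2)%:E).
  exact: integrableS iv.
apply: (le_trans (cauchy_schwarz_itv ab _ iv')); first exact: measurable_funS mv.
apply: ler_wpM2l; first by lra.
rewrite /energy /Rintegral fine_le//; try exact: integrable_fin_num.
apply: ge0_subset_integral => //.
- exact: (measurable_int _ iv).
- by move=> x _; rewrite lee_fin sqr_ge0.
Qed.

Lemma sq_integrable_comb v1 v2 (c : R) :
  measurable_fun (`[0, 1]%classic : set R) v1 -> measurable_fun (`[0, 1]%classic : set R) v2 ->
  mu.-integrable (`[0, 1]%classic : set R) (fun x => (v1 x ^+ 2)%:E) ->
  mu.-integrable (`[0, 1]%classic : set R) (fun x => (v2 x ^+ 2)%:E) ->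
  mu.-integrable (`[0, 1]%classic : set R) (fun x => ((c * v1 x + v2 x) ^+ 2)%:E).
Proof.
move=> m1 m2 i1 i2.
apply: (@le_integrable _ _ _ mu _ _ _ (fun x => (2 * c ^+ 2)%:E * (v1 x ^+ 2)%:E + 2%:E * (v2 x ^+ 2)%:E)%E) => //.
- apply/measurable_EFinP; apply: measurable_funX.
  by apply: measurable_funD => //; apply: measurable_funM => //; exact: measurable_cst.
- move=> x _; rewrite -!EFinM -EFinD /= lee_fin ger0_norm ?sqr_ge0// ger0_norm; last first.
    by rewrite addr_ge0// mulr_ge0 ?sqr_ge0// mulr_ge0// sqr_ge0.
  by have := sqr_ge0 (c * v1 x - v2 x); nra.
- by apply: integrableD => //; exact: integrableZl.
Qed.

Lemma primitive_sq_le g v x : primitive g v -> 0 <= x <= 1 ->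
  g x ^+ 2 <= 2 * g 0 ^+ 2 + 2 * energy v.
Proof.
move=> gv /andP[x0 x1]; have := primitive_holder gv (lexx 0) x0 x1.
have E0 := energy_ge0 v; rewrite subr0 => h.
have h' : (g x - g 0) ^+ 2 <= energy v by apply: (le_trans h); exact: ler_piMl.
by have := sqr_ge0 (g x - 2 * g 0); nra.
Qed.

Lemma primitive_comb g1 v1 g2 v2 (c : R) : primitive g1 v1 -> primitive g2 v2 ->
  primitive (fun x => c * g1 x + g2 x) (fun x => c * v1 x + v2 x).
Proof.
move=> p1 p2; have [m1 i1 e1] := p1; have [m2 i2 e2] := p2.
have m12 : measurable_fun (`[0, 1]%classic : set R) (fun x => c * v1 x + v2 x).
  by apply: measurable_funD => //; apply: measurable_funM => //; exact: measurable_cst.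
split => //.
- exact: sq_integrable_comb.
- move=> a b a0 ab b1; have sub := sub_itv01 a0 b1.
  have j1 : mu.-integrable `[a, b]%classic (EFin \o v1).
    exact: integrableS (primitive_integrable p1).
  have j2 : mu.-integrable `[a, b]%classic (EFin \o v2).
    exact: integrableS (primitive_integrable p2).
  rewrite RintegralD//; last exact: (integrableZl _ c j1).
  by rewrite RintegralZl// -e1// -e2//; ring.
Qed.

End primitive.

(** * The fundamental theorem of calculus for absolutely continuous functions *)

Section primitive_ac.
Variable R : realType.
Local Notation mu := (@lebesgue_measure R).
Implicit Types (g v : R -> R).

Lemma sumr_integral_itv_le (f : R -> R) n (a b : 'I_n -> R) :
  mu.-integrable `[0, 1]%classic (EFin \o f) -> (forall x, 0 <= f x) ->
  (forall i, 0 <= a i /\ a i <= b i /\ b i <= 1) ->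
  trivIset [set: 'I_n] (fun i => `]a i, b i[%classic) ->
  \sum_(i < n) \int[mu]_(x in `[a i, b i]%classic) f x <=
  \int[mu]_(x in `[0, 1]%classic) f x.
Proof.
move=> fi f0 ab tI.
have mf := measurable_int _ fi.
have sub i : `]a i, b i[%classic `<=` `[0, 1]%classic.
  by move=> x /=; rewrite !in_itv/=; have := ab i; lra.
have subD : \big[setU/set0]_(i <- index_enum 'I_n) `]a i, b i[%classic `<=` `[0, 1]%classic.
  by rewrite -bigcup_seq => x [i _ /sub].
have eqi i : (\int[mu]_(x in `[a i, b i]%classic) (f x)%:E =
    \int[mu]_(x in `]a i, b i[%classic) (f x)%:E)%E.
  by apply: integral_itv_bndoo; apply: measurable_funS mf => //; exact: sub.
have fin i : (\int[mu]_(x in `]a i, b i[%classic) (f x)%:E)%E \is a fin_num.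
  by apply: integrable_fin_num => //; apply: integrableS fi => //; exact: sub.
rewrite -lee_fin -sumEFin [leRHS]fineK; last exact: integrable_fin_num.
rewrite (eq_bigr (fun i => \int[mu]_(x in `]a i, b i[%classic) (f x)%:E)%E); last first.
  by move=> i _; rewrite /Rintegral eqi fineK.
rewrite -[leLHS](@ge0_integral_bigsetU _ _ _ mu _ (fun i => `]a i, b i[%classic)) //.
- apply: ge0_subset_integral => //; first exact: bigsetU_measurable.
  by move=> x _; rewrite lee_fin.
- exact: index_enum_uniq.
- by apply: sub_trivIset tI.
- by apply: measurable_funS mf.
- by move=> x _; rewrite lee_fin.
Qed.

(** On an interval of length [l], Cauchy-Schwarz followed by the inequality of
    arithmetic and geometric means bounds the increment of [g] by
    [c * \int v^2 + l / (4 * c)]; a small [c] makes the sum of the first terms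
    small, then a small total length that of the second ones. *)
Lemma primitive_ac g v : primitive g v -> absolutely_continuous g.
Proof.
move=> gv e e0; have [mv iv gi] := gv.
have S0 := energy_ge0 v; set S := energy v in S0.
pose c := e / (2 * (S + 1)).
have c0 : 0 < c by rewrite divr_gt0// mulr_gt0//; lra.
exists (2 * c * e); first by apply: mulr_gt0 => //; apply: mulr_gt0.
move=> n a b ab tI lt.
have iab i : mu.-integrable `[a i, b i]%classic (fun x => (v x ^+ 2)%:E).
  by apply: integrableS iv => //; have [? [? ?]] := ab i; exact: sub_itv01.
have key i : `|g (b i) - g (a i)| <=
    c * \int[mu]_(x in `[a i, b i]%classic) v x ^+ 2 + (b i - a i) / (4 * c).
  have [a0 [aibi b1]] := ab i.
  have := primitive_increment gv a0 aibi b1.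
  have mvi : measurable_fun `[a i, b i]%classic v by apply: measurable_funS mv => //; exact: sub_itv01.
  have := cauchy_schwarz_itv aibi mvi (iab i).
  move=> + ->; set I := \int[mu]_(x in _) v x; set J := \int[mu]_(x in _) v x ^+ 2 => IJ.
  have J0 : 0 <= J by apply: Rintegral_ge0 => x _; exact: sqr_ge0.
  have l0 : 0 <= (b i - a i) / (4 * c) by apply: divr_ge0; [lra|apply: mulr_ge0; lra].
  rewrite -[leRHS]ger0_norm; last by rewrite addr_ge0// mulr_ge0// ltW.
  rewrite -ler_sqr ?nnegrE// !real_normK ?num_real// (le_trans IJ)//.
  have -> : (b i - a i) * J = 4 * (c * J) * ((b i - a i) / (4 * c)).
    by field; rewrite gt_eqF.
  set p := c * J; set q := (b i - a i) / (4 * c).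
  by have := sqr_ge0 (p - q); nra.
apply: (@le_lt_trans _ _ (\sum_(i < n) (c * \int[mu]_(x in `[a i, b i]%classic) v x ^+ 2 + (b i - a i) / (4 * c)))).
  by apply: ler_sum => i _; exact: key.
rewrite big_split/= -mulr_sumr -mulr_suml.
have : \sum_(i < n) \int[mu]_(x in `[a i, b i]%classic) v x ^+ 2 <= S.
  by apply: sumr_integral_itv_le => // x; exact: sqr_ge0.
set A := \sum_(i < n) _ => AS.
have h1 : c * A <= e / 2.
  have -> : e / 2 = c * (S + 1) by rewrite /c; field; apply/eqP; lra.
  by apply: ler_wpM2l; lra.
have h2 : (\sum_(i < n) (b i - a i)) / (4 * c) < e / 2.
  rewrite ltr_pdivrMr; last by lra.
  have -> : e / 2 * (4 * c) = 2 * c * e by field.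
  exact: lt.
by lra.
Qed.

(** Extending [v] by 0 outside [0,1] makes this defined and differentiable also
    across the endpoints. *)
Definition indef v (x : R) : R :=
  \int[mu]_(t in `]-oo, x]%classic) (v \_ (`[0, 1]%classic : set R)) t.

Lemma integrable_patch01 v : mu.-integrable `[0, 1]%classic (EFin \o v) ->
  mu.-integrable setT (EFin \o (v \_ (`[0, 1]%classic : set R))).
Proof.
move=> vi; rewrite -restrict_EFin.
apply/integrable_restrict => //; rewrite setTI; exact: vi.
Qed.

Lemma indef_primitive v : measurable_fun (`[0, 1]%classic : set R) v ->
  mu.-integrable (`[0, 1]%classic : set R) (fun x => (v x ^+ 2)%:E) ->
  primitive (indef v) v.
Proof.
move=> mv iv; split => // a b a0 ab b1.
have vi := sq_integrable_integrable mv iv.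
have wi := integrable_patch01 vi.
rewrite /indef (@Rintegral_itvB _ _ _ (BRight b) a) ?bnd_simp//; last first.
  exact: integrableS wi.
rewrite Rintegral_itv_obnd_cbnd; last exact: integrableS wi.
apply: eq_Rintegral => x; rewrite inE/= in_itv/= => xab; rewrite patchE mem_set//=.
by rewrite in_itv/=; lra.
Qed.

(** Lebesgue's differentiation theorem. *)
Lemma indef_slope v : mu.-integrable `[0, 1]%classic (EFin \o v) ->
  {ae mu, forall t, 0 <= t <= 1 -> slope (indef v) t (v t)}.
Proof.
move=> vi; have wi := integrable_patch01 vi.
have iy y : mu.-integrable `]-oo, y]%classic (EFin \o (v \_ (`[0, 1]%classic : set R))).
  exact: integrableS wi.
have := FTC1Ny iy (open_integrable_locally openT wi).
apply: lebesgue_aeS => t [dF eF] t01 e e0.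
have : is_derive t 1 (indef v) (v t).
  split => //; rewrite -derive1E; apply: etrans eF _; rewrite patchE mem_set//=.
move=> /is_derive1_caratheodory[q [qE qc qt]].
have /cvgrPdist_le/(_ _ e0) := qc; move=> /nbhs_ballP[r /= r0 hr].
exists r => // x x01 xt.
have -> : indef v x - indef v t - v t * (x - t) = (q x - q t) * (x - t).
  by rewrite qE qt; ring.
rewrite normrM ler_wpM2r// distrC; apply: hr; rewrite /ball/= distrC//.
Qed.

Lemma slopeB g1 g2 t l1 l2 : slope g1 t l1 -> slope g2 t l2 ->
  slope (fun x => g1 x - g2 x) t (l1 - l2).
Proof.
move=> s1 s2 e e0; have e2 : 0 < e / 2 by lra.
have [r1 r10 h1] := s1 _ e2; have [r2 r20 h2] := s2 _ e2.
exists (Num.min r1 r2); first by rewrite lt_min r10.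
move=> x x01; rewrite lt_min => /andP[x1 x2].
have -> : g1 x - g2 x - (g1 t - g2 t) - (l1 - l2) * (x - t) =
  (g1 x - g1 t - l1 * (x - t)) - (g2 x - g2 t - l2 * (x - t)) by ring.
rewrite (le_trans (ler_normB _ _))// (le_trans (lerD (h1 _ x01 x1) (h2 _ x01 x2)))//.
by lra.
Qed.

Lemma slope_eq01 g1 g2 (c : R) t l : (forall x, 0 <= x <= 1 -> g1 x = g2 x + c) ->
  0 <= t <= 1 -> slope g2 t l -> slope g1 t l.
Proof.
move=> eg t01 s e e0; have [r r0 h] := s _ e0; exists r => // x x01 xt.
have -> : g1 x - g1 t = g2 x - g2 t by rewrite !eg//; ring.
exact: h.
Qed.

Lemma absolutely_continuousB g1 g2 : absolutely_continuous g1 -> absolutely_continuous g2 ->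
  absolutely_continuous (fun x => g1 x - g2 x).
Proof.
move=> s1 s2 e e0; have e2 : 0 < e / 2 by lra.
have [r1 r10 h1] := s1 _ e2; have [r2 r20 h2] := s2 _ e2.
exists (Num.min r1 r2); first by rewrite lt_min r10.
move=> n a b ab tI; rewrite lt_min => /andP[x1 x2].
apply: (@le_lt_trans _ _ (\sum_(i < n) (`|g1 (b i) - g1 (a i)| + `|g2 (b i) - g2 (a i)|))).
  apply: ler_sum => i _.
  have -> : g1 (b i) - g2 (b i) - (g1 (a i) - g2 (a i)) =
    (g1 (b i) - g1 (a i)) - (g2 (b i) - g2 (a i)) by ring.
  exact: ler_normB.
by rewrite big_split/=; have := h1 _ _ _ ab tI x1; have := h2 _ _ _ ab tI x2; lra.
Qed.

(** The fundamental theorem of calculus for absolutely continuous functions: [g]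
    and the indefinite integral of [v] have the same derivative almost
    everywhere, so their difference is constant. *)
Lemma ac_primitive g v : absolutely_continuous g ->
  {ae mu, forall t, 0 <= t <= 1 -> slope g t (v t)} ->
  measurable_fun (`[0, 1]%classic : set R) v ->
  mu.-integrable (`[0, 1]%classic : set R) (fun x => (v x ^+ 2)%:E) ->
  primitive g v.
Proof.
move=> acg sg mv iv; have Fv := indef_primitive mv iv.
have gF : forall b, 0 <= b <= 1 -> g b - indef v b = g 0 - indef v 0.
  apply: (@ac_slope0_constant _ (fun x => g x - indef v x)).
    by apply: absolutely_continuousB => //; exact: primitive_ac Fv.
  have sF := indef_slope (primitive_integrable Fv).
  apply: lebesgue_aeS2 sg sF => t h1 h2 t01.
  by rewrite -(subrr (v t)); apply: slopeB; [exact: h1|exact: h2].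
split => // a b a0 ab b1; rewrite -(primitive_increment Fv a0 ab b1).
have := gF a; have := gF b; move=> /(_ _)/[swap]/(_ _).
by move=> h1 h2; have := h1 _; have := h2 _; lra.
Qed.

Lemma primitive_slope g v : primitive g v ->
  {ae mu, forall t, 0 <= t <= 1 -> slope g t (v t)}.
Proof.
move=> gv; have Fv := indef_primitive (primitive_measurable gv) (primitive_sq_integrable gv).
have := indef_slope (primitive_integrable gv).
apply: lebesgue_aeS => t h t01; apply: (slope_eq01 (c := g 0 - indef v 0) _ t01 (h t01)) => x /andP[x0 x1].
have := primitive_increment gv (lexx 0) x0 x1.
by have := primitive_increment Fv (lexx 0) x0 x1; lra.
Qed.

End primitive_ac.

(** * The energy as a limit of discrete energies *)

Section discrete_energy.
Variable R : realType.
Local Notation mu := (@lebesgue_measure R).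
Implicit Types (g v : R -> R).

(** Fatou's lemma, in the form in which a lower bound below the limit integral is
    eventually passed by any upper bounds [a n] of the integrals. *)
Lemma fatou_ae_near (D : set R) (h : nat -> R -> R) (f : R -> R) (a : nat -> R) (c : R) :
  measurable D -> (forall n, measurable_fun D (h n)) -> measurable_fun D f ->
  (forall n x, 0 <= h n x) -> (forall x, 0 <= f x) ->
  {ae mu, forall x, D x -> h n x @[n --> \oo] --> f x} ->
  (forall n, (\int[mu]_(x in D) (h n x)%:E <= (a n)%:E)%E) ->
  (c%:E < \int[mu]_(x in D) (f x)%:E)%E -> \forall n \near \oo, c < a n.
Proof.
move=> mD mh mf h0 f0 hf ha cf.
pose u n := fun x => (h n x)%:E.
have mu' n : measurable_fun D (u n) by exact/measurable_EFinP.
have h1 : (\int[mu]_(x in D) (f x)%:E <= \int[mu]_(x in D) limn_einf (u^~ x))%E.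
  apply: ae_ge0_le_integral => //.
  - by move=> x _; rewrite lee_fin.
  - exact/measurable_EFinP.
  - move=> x _; rewrite limn_einf_lim; apply: lime_ge; first exact: is_cvg_einfs.
    by apply: nearW => n; apply: le_ereal_inf_tmp => _ [m _ <-]; rewrite lee_fin.
  - apply: (@emeasurable_fun_cvg _ _ R D (fun n x => einfs (u^~ x) n)).
      by move=> n; exact: measurable_fun_einfs.
    by move=> x _; rewrite limn_einf_lim; exact: is_cvg_einfs.
  - apply: lebesgue_aeS hf => x hx Dx; rewrite (_ : limn_einf _ = (f x)%:E)//.
    by apply: (cvg_limn_einf_sup _).1; apply: cvg_EFin; [exact: nearW|exact: hx].
have u0 n x : D x -> (0 <= u n x)%E by rewrite lee_fin.
have h3 := lt_le_trans cf (le_trans h1 (fatou mu mD mu' u0)).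
have h4 : limn_einf (fun n => \int[mu]_(x in D) u n x)%E =
    ereal_sup (range (einfs (fun n => \int[mu]_(x in D) u n x)%E)).
  by rewrite limn_einf_lim; apply/cvg_lim => //; exact: cvg_einfs_sup.
move: h3; rewrite h4 => /ereal_sup_gt[_ [N _ <-]] hN.
exists N => // n /= Nn.
rewrite -lte_fin (lt_le_trans hN)// (le_trans _ (ha n))//.
by apply: ereal_inf_lbound; exists n.
Qed.

Definition node (n k : nat) : R := k%:R / n.+1%:R.

(** The squared L^2 norm of the derivative of the function interpolating [g]
    linearly at the nodes [k / n.+1]. *)
Definition discrete_energy n g : R :=
  n.+1%:R * \sum_(k < n.+1) (g (node n k.+1) - g (node n k)) ^+ 2.

Lemma node_ge0 n k : 0 <= node n k. Proof. by rewrite divr_ge0. Qed.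

Lemma node_le1 n k : (k <= n.+1)%N -> node n k <= 1.
Proof. by move=> kn; rewrite ler_pdivrMr// mul1r ler_nat. Qed.

Lemma nodeS n k : node n k.+1 = node n k + n.+1%:R^-1.
Proof. by rewrite /node -natr1 mulrDl mul1r. Qed.

Lemma node_mono n k l : (k <= l)%N -> node n k <= node n l.
Proof. by move=> kl; rewrite ler_pM2r ?invr_gt0// ler_nat. Qed.

Lemma node_uniq n (k l : nat) x : node n k <= x < node n k.+1 ->
  node n l <= x < node n l.+1 -> k = l.
Proof.
move=> /andP[k1 k2] /andP[l1 l2].
have h (i j : nat) : node n i <= x -> x < node n j -> (i < j)%N.
  move=> a b; rewrite -(ltr_nat R).
  by have := le_lt_trans a b; rewrite /node ltr_pM2r ?invr_gt0.
by apply/eqP; rewrite eqn_leq -ltnS h//= -ltnS h.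
Qed.

(** Cauchy-Schwarz on each cell. *)
Lemma discrete_energy_le n g v : primitive g v -> discrete_energy n g <= energy v.
Proof.
move=> gv; have [mv iv gi] := gv; rewrite /discrete_energy mulr_sumr.
apply: le_trans (sumr_integral_itv_le (a := fun k : 'I_n.+1 => node n k) (b := fun k : 'I_n.+1 => node n k.+1) iv _ _ _).
- apply: ler_sum => k _.
  have n0 : 0 <= node n k := node_ge0 n k.
  have n1 : node n k.+1 <= 1 by apply: node_le1.
  have nn : node n k <= node n k.+1 by exact: node_mono.
  rewrite gi//.
  have : measurable_fun `[node n k, node n k.+1]%classic v.
    by apply: measurable_funS mv => //; exact: sub_itv01.
  move=> /(cauchy_schwarz_itv nn)/(_ _)/le_trans.
  rewrite -ler_pdivlMl// mulrC; apply.
    by apply: integrableS iv => //; exact: sub_itv01.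
  by rewrite nodeS addrAC subrr add0r mulrC.
- by move=> x; exact: sqr_ge0.
- by move=> k; split; [exact: node_ge0|split; [exact: node_mono|exact: node_le1]].
- apply/trivIsetP => k l _ _ kl; apply/seteqP; split => // x [] /=.
  rewrite !in_itv/= => /andP[k1 k2] /andP[l1 l2]; move/eqP: kl; apply.
  by apply/val_inj/(@node_uniq n k l x); rewrite ltW.
Qed.

Lemma node_trunc n x : 0 <= x < 1 -> exists k : 'I_n.+1, node n k <= x < node n k.+1.
Proof.
move=> /andP[x0 x1].
have h : 0 <= x * n.+1%:R by rewrite mulr_ge0.
have /andP[t1 t2] := truncn_itv h.
have tn : (Num.truncn (x * n.+1%:R) < n.+1)%N.
  by rewrite -(ltr_nat R) (le_lt_trans t1)// gtr_pMl.
exists (Ordinal tn) => /=.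
by rewrite /node ler_pdivrMr// ltr_pdivlMr// t1 t2.
Qed.

(** The square of the derivative of the interpolating function, which is a step
    function. *)
Definition sq_quotient n g (x : R) : R :=
  \sum_(k < n.+1) (n.+1%:R * (g (node n k.+1) - g (node n k))) ^+ 2 *
    \1_(`[node n k, node n k.+1[%classic) x.

(** The cell containing [x] shrinks to [x], and difference quotients over
    intervals that contain a point of differentiability converge to the derivative. *)
Lemma sq_quotient_cvg g x l : 0 <= x < 1 -> slope g x l ->
  sq_quotient n g x @[n --> \oo] --> l ^+ 2.
Proof.
move=> x01 s.
pose k n := sval (cid (node_trunc n x01)).
have kx n : node n (k n) <= x < node n (k n).+1 by exact: (svalP (cid (node_trunc n x01))).
have E n : sq_quotient n g x = (n.+1%:R * (g (node n (k n).+1) - g (node n (k n)))) ^+ 2.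
  rewrite /sq_quotient (bigD1 (k n))//= big1 ?addr0.
    by rewrite indicE mem_set ?mulr1//= in_itv/=.
  move=> j jk; rewrite indicE memNset ?mulr0//=.
  rewrite in_itv/= => jx; move/eqP: jk; apply.
  exact/val_inj/(node_uniq jx (kx n)).
under eq_fun do rewrite E.
suff : n.+1%:R * (g (node n (k n).+1) - g (node n (k n))) @[n --> \oo] --> l.
  by move=> h; rewrite expr2; under eq_fun do rewrite expr2; exact: cvgM.
apply/cvgrPdist_le => e e0; have [r r0 hr] := s _ e0.
have /cvgrPdist_lt/(_ _ r0) := @cvg_harmonic R.
apply: filterS => n /=; rewrite sub0r normrN /harmonic ger0_norm ?invr_ge0// => nr.
have /andP[kx1 kx2] := kx n.
set a := node n (k n) in kx1 *; set b := node n (k n).+1 in kx2 *.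
have [h [hE hr']] : exists h : R, b = a + h /\ h < r by exists n.+1%:R^-1; rewrite -nodeS.
have a01 : 0 <= a <= 1 by rewrite node_ge0 node_le1// ltnW.
have b01 : 0 <= b <= 1 by rewrite node_ge0 node_le1.
have ha : `|g a - g x - l * (a - x)| <= e * (x - a).
  rewrite [e * _](_ : _ = e * `|a - x|); last by rewrite distrC ger0_norm//; lra.
  by apply: hr => //; rewrite distrC ger0_norm ?subr_ge0//; lra.
have hb : `|g b - g x - l * (b - x)| <= e * (b - x).
  rewrite [e * _](_ : _ = e * `|b - x|); last by rewrite ger0_norm//; lra.
  by apply: hr => //; rewrite ger0_norm ?subr_ge0 ?ltW//; lra.
have ba : n.+1%:R * (b - a) = 1 by rewrite [b]nodeS addrAC subrr add0r mulfV// pnatr_eq0.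
have -> : l - n.+1%:R * (g b - g a) =
    n.+1%:R * ((g a - g x - l * (a - x)) - (g b - g x - l * (b - x))).
  by transitivity (l * (n.+1%:R * (b - a)) - n.+1%:R * (g b - g a)); [rewrite ba mulr1|ring].
rewrite normrM ger0_norm//.
have -> : e = n.+1%:R * (e * (b - a)) by rewrite mulrCA ba mulr1.
apply: ler_wpM2l => //; rewrite (le_trans (ler_normB _ _))//.
by have := lerD ha hb; lra.
Qed.

Lemma integral_sq_quotient n g :
  (\int[mu]_(x in `[0%R, 1%R]%classic) (sq_quotient n g x)%:E <= (discrete_energy n g)%:E)%E.
Proof.
rewrite /sq_quotient; under eq_integral do rewrite -sumEFin.
rewrite ge0_integral_sum//; last 2 first.
- by move=> k; apply/measurable_EFinP; apply: measurable_funM.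
- by move=> k x _; rewrite lee_fin mulr_ge0// sqr_ge0.
rewrite /discrete_energy mulr_sumr -sumEFin; apply: lee_sum => k _.
under eq_integral do rewrite EFinM.
rewrite ge0_integralZl//; [|exact/measurable_EFinP|by rewrite lee_fin sqr_ge0].
rewrite integral_indic//.
set q := g _ - g _.
apply: (@le_trans _ _ (((n.+1%:R * q) ^+ 2)%:E * mu `[node n k, node n k.+1[%classic)%E).
  apply: lee_wpmul2l; first by rewrite lee_fin sqr_ge0.
  by apply: le_measure; rewrite ?inE//; exact: measurableI.
rewrite lebesgue_measure_itv/= lte_fin nodeS ltrDl invr_gt0 ltr0Sn -EFinB -EFinM lee_fin.
rewrite addrAC subrr add0r.
by rewrite le_eqVlt; apply/orP; left; apply/eqP; field.
Qed.

(** The discrete energies are at most the energy; that they come close to it is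
    Fatou's lemma applied to the squared difference quotients. *)
Lemma discrete_energy_cvg g v : primitive g v ->
  discrete_energy n g @[n --> \oo] --> energy v.
Proof.
move=> gv; apply/cvgrPdist_le => e e0.
have [mv iv _] := gv.
have : \forall n \near \oo, energy v - e < discrete_energy n g.
  apply: (@fatou_ae_near `[0, 1]%classic (sq_quotient^~ g) (fun x => v x ^+ 2)) => //.
  - by move=> n; apply: measurable_sum => k; apply: measurable_funM.
  - exact: measurable_funX.
  - by move=> n x; apply: sumr_ge0 => k _; rewrite mulr_ge0// sqr_ge0.
  - by move=> x; exact: sqr_ge0.
  - have h1 : mu.-negligible [set 1 : R].
      by exists [set 1]; split => //; exact: lebesgue_measure_set1.
    have h2 := primitive_slope gv.
    have h1' : {ae mu, forall x : R, x != 1}.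
      by apply: negligibleS h1 => x /=; case: eqVneq.
    apply: lebesgue_aeS2 h1' h2 => x x1 hx; rewrite /= in_itv/= => x01; apply: sq_quotient_cvg; last exact: hx.
    by move: x01 => /andP[-> ]; rewrite le_eqVlt (negbTE x1).
  - by move=> n; exact: integral_sq_quotient.
  - rewrite -[ltRHS]fineK; last exact: integrable_fin_num.
    by rewrite lte_fin; change (energy v - e < energy v); lra.
apply: filterS => n h.
by rewrite ger0_norm ?subr_ge0 ?discrete_energy_le//; lra.
Qed.

End discrete_energy.

(** * Integrals of nonmeasurable functions *)

Section nonmeasurable_integrand.
Context d (T : measurableType d) (R : realType) (m : {measure set T -> \bar R}).

(** Monotonicity without measurability of the smaller integrand [F]: the integral
    of a nonnegative function is the supremum of the integrals of the simple
    functions below it, and each of those lies almost everywhere below [G]. This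
    applies to the derivative of order s of a difference of curves, which is known
    only up to a null set. *)
Lemma ae_ge0_le_integral_nonmeasurable (D : set T) (F G : T -> \bar R) :
  measurable D -> (forall x, D x -> (0 <= F x)%E) ->
  (forall x, D x -> (0 <= G x)%E) -> measurable_fun D G ->
  {ae m, forall x, D x -> (F x <= G x)%E} ->
  (\int[m]_(x in D) F x <= \int[m]_(x in D) G x)%E.
Proof.
move=> mD F0 G0 mG FG; rewrite [leLHS]integral_mkcond [leRHS]integral_mkcond.
rewrite ge0_integralTE; last by move=> x; exact: erestrict_ge0.
apply: ge_ereal_sup => _ [h /= hF <-].
rewrite -integralT_nnsfun; apply: ae_ge0_le_integral => //.
- by move=> x _; rewrite lee_fin fun_ge0.
- exact/measurable_EFinP.
- by move=> x _; exact: erestrict_ge0.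
- exact/(measurable_restrictT _ _).1.
- apply: filterS FG => x FGx _; apply: (le_trans (hF x)); rewrite !patchE.
  by case: ifPn => // /set_mem /FGx.
Qed.

End nonmeasurable_integrand.

(** * Jets and their convergence *)

Section jets.
Variable R : realType.
Implicit Types (v : R -> R) (s : nat) (g : nat -> R -> R).

Lemma energy_le_cst v (C : R) : (forall x, 0 <= x <= 1 -> v x ^+ 2 <= C) -> energy v <= C.
Proof.
move=> vC; have C0 : 0 <= C by apply: le_trans (vC 0 _); rewrite ?sqr_ge0// lexx ler01.
have h : (\int[@lebesgue_measure R]_(x in `[0%R, 1%R]%classic) (v x ^+ 2)%:E <= C%:E)%E.
  apply: (@le_trans _ _ (\int[@lebesgue_measure R]_(x in `[0%R, 1%R]%classic) C%:E)%E).
    apply: ae_ge0_le_integral_nonmeasurable => //.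
    - by move=> x _; rewrite lee_fin sqr_ge0.
    - by apply: aeW => x /=; rewrite in_itv/= lee_fin; exact: vC.
  rewrite integral_cst//.
  rewrite -[leRHS]mule1; apply: lee_wpmul2l; first by rewrite lee_fin.
  change (@lebesgue_measure R `[0%R, 1%R]%classic <= 1)%E.
  by rewrite lebesgue_measure_itv/= lte01 sube0.
rewrite /energy /Rintegral.
rewrite -[leRHS]/(fine C%:E) fine_le//.
rewrite ge0_fin_numE; first exact: le_lt_trans h (ltry _).
by apply: integral_ge0 => x _; rewrite lee_fin sqr_ge0.
Qed.

(** A coordinate of a curve with its derivatives up to order [s], the last one
    understood up to a null set. *)
Definition jet s (g : nat -> R -> R) : Prop :=
  forall i, (i < s)%N -> primitive (g i) (g i.+1).

(** The square of a norm equivalent to that of H^s, chosen to depend on point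
    values and on a single energy. *)
Definition jet_sqnorm s (g : nat -> R -> R) : R :=
  \sum_(i < s) g i 0 ^+ 2 + energy (g s).

Lemma jet_sqnorm_ge0 s g : 0 <= jet_sqnorm s g.
Proof. by rewrite addr_ge0 ?energy_ge0// sumr_ge0// => i _; exact: sqr_ge0. Qed.

Lemma energy_primitive_le (g v : R -> R) : primitive g v -> energy g <= 2 * g 0 ^+ 2 + 2 * energy v.
Proof. by move=> gv; apply: energy_le_cst => x; exact: primitive_sq_le.
Qed.

Lemma jet_energy_le s g i : jet s g -> (i <= s)%N ->
  energy (g i) <= 4 ^+ (s - i) * jet_sqnorm s g.
Proof.
move=> js; move: {1 3}(s - i)%N (erefl (s - i)%N) => n; elim: n i => [|n ih] i sin is_.
  have -> : i = s by apply/eqP; rewrite eqn_leq is_/= -subn_eq0 sin.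
  by rewrite expr0 mul1r /jet_sqnorm lerDr sumr_ge0// => j _; exact: sqr_ge0.
have ilt : (i < s)%N by rewrite -subn_gt0 -sin.
have := energy_primitive_le (js i ilt).
have := ih i.+1 _ ilt; rewrite subnS -sin => /(_ erefl).
have g0 : g i 0 ^+ 2 <= jet_sqnorm s g.
  rewrite /jet_sqnorm (bigD1 (Ordinal ilt))//= -addrA lerDl addr_ge0 ?energy_ge0//.
  by rewrite sumr_ge0// => j _; exact: sqr_ge0.
have e1 : 1 <= 4 ^+ n :> R by rewrite exprn_ege1//; lra.
have q0 := jet_sqnorm_ge0 s g.
rewrite [4 ^+ n.+1]exprS; set Q := jet_sqnorm s g in g0 q0 *; set p : R := 4 ^+ n in e1 *.
by have : 0 <= (p - 1) * Q; [apply: mulr_ge0; lra | lra].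
Qed.

Lemma jet_comb s g1 g2 (c : R) : jet s g1 -> jet s g2 ->
  jet s (fun i x => c * g1 i x + g2 i x).
Proof. by move=> j1 j2 i si; apply: primitive_comb; [exact: j1|exact: j2]. Qed.

Lemma jet_oscillation s g a b : (0 < s)%N -> jet s g -> 0 <= a -> a <= b -> b <= 1 ->
  (g 0%N b - g 0%N a) ^+ 2 <= (b - a) * (4 ^+ s * jet_sqnorm s g).
Proof.
move=> s0 js a0 ab b1; apply: (le_trans (primitive_holder (js _ s0) a0 ab b1)).
apply: ler_wpM2l; first by lra.
apply: (le_trans (jet_energy_le js s0)).
rewrite ler_wpM2r ?jet_sqnorm_ge0// ler_weXn2l ?leq_subr//; lra.
Qed.

(** The identity is algebraic for discrete energies. *)
Lemma energy_parallelogram (g1 v1 g2 v2 : R -> R) : primitive g1 v1 -> primitive g2 v2 ->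
  energy (fun x => -1 * v1 x + v2 x) + energy (fun x => 1 * v1 x + v2 x) =
  2 * energy v1 + 2 * energy v2.
Proof.
move=> p1 p2.
have c1 := discrete_energy_cvg (primitive_comb (-1) p1 p2).
have c2 := discrete_energy_cvg (primitive_comb 1 p1 p2).
have d1 := discrete_energy_cvg p1; have d2 := discrete_energy_cvg p2.
have c : discrete_energy n (fun x => -1 * g1 x + g2 x) +
    discrete_energy n (fun x => 1 * g1 x + g2 x) @[n --> \oo] -->
    energy (fun x => -1 * v1 x + v2 x) + energy (fun x => 1 * v1 x + v2 x).
  exact: cvgD.
have d : 2 * discrete_energy n g1 + 2 * discrete_energy n g2 @[n --> \oo] -->
    2 * energy v1 + 2 * energy v2.
  by apply: cvgD; apply: cvgM => //; exact: cvg_cst.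
apply: (cvg_unique (@Rhausdorff R) c).
apply: cvg_trans d; apply: near_eq_cvg; apply: nearW => n /=.
rewrite /discrete_energy !mulr_sumr -!big_split/=.
by apply: eq_bigr => k _; ring.
Qed.

End jets.

(** [G n] is a sequence of finite families of jets whose components of order less
    than [s] converge pointwise; [U n] is the difference to the limit family. *)
Section families.
Variables (R : realType) (I : finType) (s : nat).
Hypothesis s_gt0 : (0 < s)%N.
Variables (G : nat -> I -> nat -> R -> R) (Goo : I -> nat -> R -> R).
Hypothesis jG : forall n a, jet s (G n a).
Hypothesis jGoo : forall a, jet s (Goo a).
Hypothesis G_cvg : forall a i t, (i < s)%N -> 0 <= t <= 1 ->
  G n a i t @[n --> \oo] --> Goo a i t.

Let U n a i x := -1 * Goo a i x + G n a i x.

Let jU n a : jet s (U n a). Proof. exact: jet_comb. Qed.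

Lemma jet_diff_near (e : R) a i t : 0 < e -> (i < s)%N -> 0 <= t <= 1 ->
  \forall n \near \oo, U n a i t ^+ 2 <= e.
Proof.
move=> e0 si t01; have /cvgrPdist_le := @G_cvg a i t si t01.
have sq : 0 < Num.sqrt e by rewrite sqrtr_gt0.
move=> /(_ _ sq); apply: filterS => n h; rewrite /U.
rewrite -(sqr_sqrtr (ltW e0)) -[leLHS]real_normK ?num_real// ler_sqr ?nnegrE ?sqrtr_ge0//.
by rewrite mulN1r addrC distrC.
Qed.

Lemma energy_diff_le n a :
  energy (U n a s) <= 2 * energy (Goo a s) + 2 * energy (G n a s).
Proof.
have s1 : (s.-1 < s)%N by rewrite prednK.
have := energy_parallelogram (jGoo a s1) (jG n a s1).
rewrite prednK// /U => <-; rewrite lerDl; exact: energy_ge0.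
Qed.

Lemma jet_init_near (e : R) : 0 < e ->
  \forall n \near \oo, forall a, \sum_(i < s) U n a i 0 ^+ 2 <= e.
Proof.
move=> e0; pose e' := e / s.+1%:R.
have e'0 : 0 < e' by rewrite divr_gt0.
have : \forall n \near \oo, forall ai : I * 'I_s, U n ai.1 ai.2 0 ^+ 2 <= e'.
  by apply: filter_forall => -[a i] /=; apply: jet_diff_near; rewrite // lexx ler01.
apply: filterS => n h a.
apply: (@le_trans _ _ (\sum_(i < s) e')); first by apply: ler_sum => i _; exact: (h (a, i)).
rewrite sumr_const card_ord -mulr_natr /e' mulrAC ler_pdivrMr// ler_wpM2l ?ler_nat ?ltW//.
Qed.

(** Bounded energy makes the differences [U n] equi-Hoelder of exponent 1/2, so on
    a sufficiently fine grid pointwise convergence at the finitely many nodes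
    controls all of [0,1]. The bound is required at the index considered, since
    it will be available along the indices at which the data are bounded. *)
Lemma bounded_energy_uniform_cvg (K e : R) : 0 < e ->
  \forall n \near \oo, (forall a, energy (G n a s) <= K) ->
    forall a t, 0 <= t <= 1 -> U n a 0%N t ^+ 2 <= e.
Proof.
move=> e0.
(* [B] bounds the squared jet norms of the differences: 1 for the values at 0,
   the rest for the energy. *)
pose B := 1 + 2 * (\sum_a energy (Goo a s)) + 2 * `|K|.
have E0 : 0 <= \sum_a energy (Goo a s) by apply: sumr_ge0 => a _; exact: energy_ge0.
have B0 : 0 < B by have := normr_ge0 K; rewrite /B; lra.
pose M := 4 ^+ s * B.
have M0 : 0 < M by rewrite mulr_gt0// exprn_gt0.
have e4M : 0 < e / (4 * M) by rewrite divr_gt0// mulr_gt0.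
have [N NM] : exists N, (N.+1%:R^-1 : R) <= e / (4 * M).
  have /cvgrPdist_le/(_ _ e4M) := @cvg_harmonic R.
  move=> [N _ /(_ N (leqnn _))]; rewrite /harmonic sub0r normrN ger0_norm ?invr_ge0// => h.
  by exists N.
have e4 : 0 < e / 4 by rewrite divr_gt0.
have h1 := jet_init_near ltr01.
have : \forall n \near \oo, forall ak : I * 'I_N.+2, U n ak.1 0%N (node R N ak.2) ^+ 2 <= e / 4.
  apply: filter_forall => -[a k] /=; apply: jet_diff_near => //.
  by rewrite node_ge0 node_le1// -ltnS.
apply: filterS2 h1 => n h1 h2 hK a t /andP[t0 t1].
have jB : 4 ^+ s * jet_sqnorm s (U n a) <= M.
  rewrite ler_wpM2l ?exprn_ge0// /jet_sqnorm /B -addrA; apply: lerD; first exact: h1.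
  apply: (le_trans (energy_diff_le n a)); apply: lerD.
    rewrite ler_wpM2l//; rewrite (bigD1 a)//= lerDl sumr_ge0// => b _; exact: energy_ge0.
  by rewrite ler_wpM2l// (le_trans (hK a))// ler_norm.
have [-> |tn1] := eqVneq t 1.
  have := h2 (a, ord_max) => /=; rewrite /node divff ?pnatr_eq0// => h.
  by apply: (le_trans h); lra.
have [|k /andP[k1 k2]] := @node_trunc R N t; first by rewrite t0 lt_neqAle tn1.
have := h2 (a, widen_ord (leqnSn _) k) => /= hk.
have := jet_oscillation s_gt0 (jU n a) (node_ge0 R N k) k1 t1.
set u := U n a 0%N t; set w := U n a 0%N (node R N k) in hk *.
set x := (t - node R N k); move=> hx.
have : (u - w) ^+ 2 <= e / 4.
  apply: (le_trans hx); apply: (@le_trans _ _ (e / (4 * M) * M)).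
    apply: ler_pM => //; first by rewrite /x; lra.
      by rewrite mulr_ge0 ?exprn_ge0// jet_sqnorm_ge0.
    by move: k2 NM; rewrite nodeS /x; set r := N.+1%:R^-1; set q := e / _; lra.
  by rewrite (_ : e / (4 * M) * M = e / 4)//; field; rewrite gt_eqF.
by have := sqr_ge0 (u - 2 * w); nra.
Qed.

(** Convergence of the energies turns pointwise into strong convergence. By the
    parallelogram identity the energy of the difference is
    [2 * E (G n) + 2 * E Goo - E (G n + Goo)], and the last energy is at least the
    discrete energy of [G n + Goo] on a fixed grid, which converges to that of
    [2 * Goo]; on a fine grid the latter is almost [4 * E Goo]. *)
Lemma energy_limsup_strong_cvg (P : nat -> Prop) :
  (forall e, 0 < e -> \forall n \near \oo, P n ->
    \sum_a energy (G n a s) <= \sum_a energy (Goo a s) + e) ->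
  forall e, 0 < e -> \forall n \near \oo, P n -> \sum_a jet_sqnorm s (U n a) <= e.
Proof.
move=> lsup e e0.
have s1 : (s.-1 < s)%N by rewrite prednK.
have sE : s = s.-1.+1 by rewrite prednK.
pose c := e / (8 * #|I|.+1%:R).
have c0 : 0 < c by rewrite divr_gt0// mulr_gt0.
have e8 : 0 < e / 8 by rewrite divr_gt0.
have h1 := lsup _ e8; have h2 := jet_init_near c0.
have h3 : \forall n \near \oo, forall a,
    4 * energy (Goo a s) - 2 * c <= energy (fun x => 1 * Goo a s x + G n a s x).
  apply: filter_forall => a.
  have p := jGoo a s1; rewrite -sE in p.
  have /cvgrPdist_le/(_ _ (divr_gt0 c0 (ltr0n R 4))) := discrete_energy_cvg p.
  move=> [N _ /(_ N (leqnn _)) hN].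
  have : discrete_energy N (fun x => 1 * Goo a s.-1 x + G n a s.-1 x) @[n --> \oo] -->
     discrete_energy N (fun x => 1 * Goo a s.-1 x + Goo a s.-1 x).
    rewrite /discrete_energy; apply: cvgM; first exact: cvg_cst.
    apply: (cvg_big (op := +%R)) => [|k _]; first exact: add_continuous.
    under eq_fun do rewrite expr2; rewrite expr2.
    have hc l : (l <= N.+1)%N -> 1 * Goo a s.-1 (node R N l) + G n a s.-1 (node R N l) @[n --> \oo] -->
       1 * Goo a s.-1 (node R N l) + Goo a s.-1 (node R N l).
      move=> lN; apply: cvgD; first exact: cvg_cst.
      by apply: G_cvg => //; rewrite node_ge0 node_le1.
    by apply: cvgM; apply: cvgB; apply: hc => //; exact: ltnW.
  move=> /cvgrPdist_le/(_ _ c0); apply: filterS => n hn.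
  have pn := primitive_comb 1 p (jG n a s1); rewrite -sE in pn.
  have := discrete_energy_le N pn.
  have d4 : discrete_energy N (fun x => 1 * Goo a s.-1 x + Goo a s.-1 x) =
      4 * discrete_energy N (Goo a s.-1).
    by rewrite /discrete_energy !mulr_sumr; apply: eq_bigr => k _; ring.
  move: hN hn; rewrite d4 !ler_norml => /andP[_ hN] /andP[_ hn] hle; lra.
apply: filterS3 h1 h2 h3 => n h1 h2 h3 Pn.
have {}h1 := h1 Pn.
apply: (@le_trans _ _ (\sum_a (c + (2 * energy (G n a s) - 2 * energy (Goo a s) + 2 * c)))).
  apply: ler_sum => a _; apply: lerD; first exact: h2.
  have := energy_parallelogram (jGoo a s1) (jG n a s1).
  rewrite -!sE -/(U n a s); have := h3 a; lra.
rewrite !big_split/= sumr_const -mulr_sumr sumrN -mulr_sumr.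
have cI : c *+ #|I| <= e / 8.
  rewrite -mulr_natr /c -[leRHS]mulr1.
  have -> : e / (8 * #|I|.+1%:R) * #|I|%:R = e / 8 * (#|I|%:R / #|I|.+1%:R).
    by rewrite invfM; ring.
  by apply: ler_wpM2l; [exact: ltW|rewrite ler_pdivrMr// mul1r ler_nat].
rewrite sumr_const -mulr_natr -mulrA mulr_natr.
lra.
Qed.

End families.

(** * Sobolev curves *)

Section derivatives.
Variables (R : realType) (d : nat).

Implicit Types (f g : R -> 'rV[R]_d).

Definition has_deriv01 f (t : R) (l : 'rV[R]_d) : Prop :=
  diff_quot f t h @[h --> increments01 t] --> l.

Lemma increments01_filter (t : R) : Filter (increments01 t).
Proof. exact: within_filter. Qed.

Lemma increments01_proper (t : R) : 0 <= t <= 1 -> ProperFilter (increments01 t).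
Proof.
move=> /andP[t0 t1]; apply: (@Build_ProperFilter_ex _ _ _ (increments01_filter t)) => A.
 rewrite /increments01 /within /= => /nbhs_ballP[r /= r0 hr].
pose q := Num.min (r / 2) (1 / 2).
have q0 : 0 < q by rewrite lt_min !divr_gt0.
have qr : q < r by apply: (@le_lt_trans _ _ (r / 2)); [rewrite ge_min lexx|lra].
have q1 : q <= 1 / 2 by rewrite ge_min lexx orbT.
have [th|th] := leP t (1 / 2).
- exists q; apply: hr; rewrite /ball/= ?sub0r ?normrN ?gtr0_norm//= ?gt_eqF//.
  by lra.
- exists (- q); apply: hr; rewrite /ball/= ?sub0r ?normrN ?gtr0_norm//= ?oppr_eq0 ?gt_eqF//.
  by lra.
Qed.

Lemma derivable01_has_deriv f t : derivable01 f t -> has_deriv01 f t (deriv01 f t).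
Proof. by []. Qed.

Lemma has_deriv01_unique f t l : 0 <= t <= 1 -> has_deriv01 f t l -> deriv01 f t = l.
Proof.
move=> t01 h; have PF := increments01_proper t01.
by apply/cvg_lim => //; exact: norm_hausdorff.
Qed.

Lemma has_deriv01_comb f g k (a : R) t l m : 0 <= t <= 1 ->
  (forall x, 0 <= x <= 1 -> k x = a *: f x + g x) ->
  has_deriv01 f t l -> has_deriv01 g t m -> has_deriv01 k t (a *: l + m).
Proof.
move=> t01 kE hf hg; have FF := increments01_filter t.
have : a *: diff_quot f t h + diff_quot g t h @[h --> increments01 t] --> a *: l + m.
  by apply: cvgD => //; apply: cvgZl_tmp.
apply: cvg_trans; apply: near_eq_cvg.
rewrite /increments01 near_withinE; apply: nearW => h /= th.
rewrite /diff_quot !kE// scalerA mulrC -scalerA -scalerDr; congr (_ *: _).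
by rewrite scalerBr opprD addrACA.
Qed.

Lemma has_deriv01_slope f t l (c : 'I_d) : 0 <= t <= 1 -> has_deriv01 f t l ->
  slope (fun x => f x ord0 c) t (l ord0 c).
Proof.
move=> t01 hf e e0; have FF := increments01_filter t.
have : diff_quot f t h ord0 c @[h --> increments01 t] --> l ord0 c.
  by apply: (@cvg_comp _ _ _ (diff_quot f t) (fun M : 'rV[R]_d => M ord0 c) _ _ _ hf); exact: coord_continuous.
move=> /cvgrPdist_le/(_ _ e0); rewrite /increments01 near_withinE.
move=> /nbhs_ballP[r /= r0 hr]; exists r => // x x01 xt.
have [->|xNt] := eqVneq x t; first by rewrite !subrr mulr0 subr0 normr0 mulr0.
have := hr (x - t); rewrite /ball/= sub0r normrN => /(_ xt); rewrite subr_eq0 => /(_ xNt).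
rewrite [t + _]addrC subrK => /(_ x01).
rewrite /diff_quot !mxE [t + _]addrC subrK => h.
have xt0 : x - t != 0 by rewrite subr_eq0.
have -> : f x ord0 c - f t ord0 c - l ord0 c * (x - t) =
    - ((l ord0 c - (x - t)^-1 * (f x ord0 c - f t ord0 c)) * (x - t)) by field.
by rewrite normrN normrM ler_wpM2r.
Qed.

Lemma enorm_sqE (v : 'rV[R]_d) : enorm v ^+ 2 = \sum_(c < d) v ord0 c ^+ 2.
Proof. by rewrite sqr_sqrtr// sumr_ge0// => c _; exact: sqr_ge0. Qed.

Lemma coord_le_enorm (v : 'rV[R]_d) c : `|v ord0 c| <= enorm v.
Proof.
rewrite -ler_sqr ?nnegrE ?sqrtr_ge0// enorm_sqE real_normK ?num_real//.
rewrite (bigD1 c)//= lerDl sumr_ge0// => j _; exact: sqr_ge0.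
Qed.

Lemma abs_continuous01_coord f c : abs_continuous01 f ->
  absolutely_continuous (fun x => f x ord0 c).
Proof.
move=> acf e e0; have [h h0 hf] := acf _ e0; exists h => // n a b ab tI sh.
apply: le_lt_trans (hf n a b ab tI sh); apply: ler_sum => i _.
by have := coord_le_enorm (f (b i) - f (a i)) c; rewrite !mxE.
Qed.

(** Composed with the retraction of the line onto [0,1], [g] is continuous. *)
Lemma ac_measurable (g : R -> R) : absolutely_continuous g ->
  measurable_fun (`[0, 1]%classic : set R) g.
Proof.
move=> acg; pose cl x : R := Num.max 0 (Num.min x 1).
have cl01 x : 0 <= cl x <= 1.
  by rewrite /cl le_max lexx/= ge_max ler01/= ge_min lexx orbT.
have clE x : 0 <= x <= 1 -> cl x = x.
  by move=> /andP[x0 x1]; rewrite /cl min_l// max_r.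
apply: (@eq_measurable_fun _ _ _ _ _ (g \o cl)).
  by move=> x; rewrite inE/= in_itv/= => x01; rewrite clE.
apply: (measurable_funS measurableT) => //.
apply: continuous_measurable_fun => x.
apply/cvgrPdist_lt => e e0; have [h h0 hg] := acg _ e0.
have key a b : 0 <= a -> a <= b -> b <= 1 -> b - a < h -> `|g b - g a| < e.
  move=> a0 ab b1 bah; have := hg 1%N (fun=> a) (fun=> b) (fun=> conj a0 (conj ab b1)).
  rewrite !big_ord1; apply => //.
  by apply/trivIsetP => i j _ _; rewrite !ord1.
apply/nbhs_ballP; exists h => // y; rewrite /ball/= => xy.
have cxy : `|cl x - cl y| < h.
  apply: le_lt_trans xy; rewrite /cl /Num.max /Num.min.
  have [?|?] := ltP x 1; have [?|?] := ltP y 1; have [?|?] := ltP 0 x; have [?|?] := ltP 0 y;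
    rewrite ?ltr01 ler_norml; have := ler_norm (x - y); have := ler_norm (y - x);
    rewrite (distrC y); lra.
have /andP[x0 x1] := cl01 x; have /andP[y0 y1] := cl01 y.
move: cxy; have [xy'|xy'] := leP (cl x) (cl y).
  by rewrite distrC ger0_norm ?subr_ge0// distrC => hh; exact: key.
by rewrite ger0_norm ?subr_ge0 ?ltW// => hh; apply: key => //; exact: ltW.
Qed.

Lemma primitive_measurable_sq (g v : R -> R) : primitive g v ->
  measurable_fun (`[0, 1]%classic : set R) g /\
  (@lebesgue_measure R).-integrable (`[0, 1]%classic : set R) (fun x => (g x ^+ 2)%:E).
Proof.
move=> gv; have mg := ac_measurable (primitive_ac gv); split => //.
apply: (@le_integrable _ _ _ (@lebesgue_measure R) _ _ _ (EFin \o cst (2 * g 0 ^+ 2 + 2 * energy v))) => //.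
- by apply/measurable_EFinP; exact: measurable_funX.
- move=> x; rewrite /= in_itv/= => x01; rewrite lee_fin.
  rewrite ger0_norm ?sqr_ge0// ger0_norm; first exact: primitive_sq_le.
  by apply: addr_ge0; apply: mulr_ge0; rewrite ?sqr_ge0 ?energy_ge0.
- exact: integrable_cst_itv.
Qed.

Lemma measurable_enorm_sq d' (T : measurableType d') (D : set T) (f : T -> 'rV[R]_d) :
  measurable D -> measurable_fun D f ->
  measurable_fun D (fun x => enorm (f x) ^+ 2).
Proof.
move=> mD mf; under eq_fun do rewrite enorm_sqE.
apply: measurable_sum => c; apply: measurable_funX.
exact: (measurableT_comp (@measurable_coord _ R d c) mf).
Qed.

Section sobolev_jet.
Variables (s : nat).

Definition curve_jet f (c : 'I_d) (i : nat) (x : R) : R := nabla i f x ord0 c.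

Lemma square_integrable01_coord f c : square_integrable01 f ->
  measurable_fun (`[0, 1]%classic : set R) (fun x => f x ord0 c) /\
  (@lebesgue_measure R).-integrable (`[0, 1]%classic : set R) (fun x => (f x ord0 c ^+ 2)%:E).
Proof.
move=> [mf fi].
have mc : measurable_fun (`[0, 1]%classic : set R) (fun x => f x ord0 c).
  exact: (measurableT_comp (@measurable_coord _ R d c) mf).
split => //; apply: (@le_integrable _ _ _ (@lebesgue_measure R) _ _ _ (fun x => (enorm (f x) ^+ 2)%:E)) => //.
- by apply/measurable_EFinP; exact: measurable_funX.
- move=> x _; rewrite lee_fin !ger0_norm ?sqr_ge0//.
  by rewrite -[leLHS]real_normK ?num_real// ler_sqr ?nnegrE ?sqrtr_ge0// coord_le_enorm.
- apply/integrableP; split; first by apply/measurable_EFinP; exact: measurable_enorm_sq.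
  by under eq_integral do rewrite gee0_abs ?lee_fin ?sqr_ge0//.
Qed.

Lemma sobolev_ae_deriv f i : sobolev s f -> (i < s)%N ->
  {ae @lebesgue_measure R, forall t, 0 <= t <= 1 ->
    has_deriv01 (nabla i f) t (nabla i.+1 f t)}.
Proof.
move=> [h1 h2 _ _] si; have [e|ne] := eqVneq i.+1 s.
  by apply: lebesgue_aeS (h2 i e) => t.
by apply: aeW => t t01; apply: h1 => //; rewrite ltn_neqAle ne.
Qed.

(** Descending induction on the order: once the derivative of order [i.+1] is
    known to be a primitive it is measurable and bounded, so the fundamental
    theorem applies to the derivative of order [i]. *)
Lemma sobolev_curve_jet f c : sobolev s f -> jet s (curve_jet f c).
Proof.
move=> sf i si.
have slp j : (j < s)%N -> {ae @lebesgue_measure R, forall t, 0 <= t <= 1 ->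
    slope (curve_jet f c j) t (curve_jet f c j.+1 t)}.
  move=> sj; apply: lebesgue_aeS (sobolev_ae_deriv sf sj) => t h t01.
  by apply: has_deriv01_slope => //; exact: h.
have acj j : (j < s)%N -> absolutely_continuous (curve_jet f c j).
  by move=> sj; apply: abs_continuous01_coord; exact: (sobolev_ac sf).
have [n sin] : exists n, n = (s - i)%N by exists (s - i)%N.
elim: n i si sin => [|n ih] i si sin; first by move: si; rewrite -subn_gt0 -sin.
have [mv iv] : measurable_fun (`[0, 1]%classic : set R) (curve_jet f c i.+1) /\
  (@lebesgue_measure R).-integrable (`[0, 1]%classic : set R) (fun x => (curve_jet f c i.+1 x ^+ 2)%:E).
  have [e|ne] := eqVneq i.+1 s.
    by rewrite e; apply: square_integrable01_coord; exact: sobolev_L2 sf.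
  have si1 : (i.+1 < s)%N by rewrite ltn_neqAle ne.
  by apply: primitive_measurable_sq (ih _ si1 _); rewrite subnS -sin.
exact: ac_primitive (acj _ si) (slp _ si) mv iv.
Qed.

Lemma sobolev_nabla_measurable f c i : sobolev s f -> (0 < s)%N -> (i <= s)%N ->
  measurable_fun (`[0, 1]%classic : set R) (curve_jet f c i) /\
  (@lebesgue_measure R).-integrable (`[0, 1]%classic : set R) (fun x => (curve_jet f c i x ^+ 2)%:E).
Proof.
move=> sf s0; rewrite leq_eqVlt => /predU1P[->|si].
  by apply: square_integrable01_coord; exact: sobolev_L2 sf.
exact: primitive_measurable_sq (sobolev_curve_jet c sf si).
Qed.

Lemma nabla_comb f g (a : R) i t : sobolev s f -> sobolev s g -> (i < s)%N -> 0 <= t <= 1 ->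
  nabla i (fun x => a *: f x + g x) t = a *: nabla i f t + nabla i g t.
Proof.
move=> sf sg; elim: i t => // i ih t si t01.
apply: has_deriv01_unique => //.
apply: (@has_deriv01_comb (nabla i f) (nabla i g)) => //.
- by move=> x x01; apply: ih => //; exact: ltnW.
- by apply: derivable01_has_deriv; exact: (sobolev_derivable sf).
- by apply: derivable01_has_deriv; exact: (sobolev_derivable sg).
Qed.

Lemma nabla_comb_ae f g (a : R) i : sobolev s f -> sobolev s g -> (i <= s)%N ->
  {ae @lebesgue_measure R, forall t, 0 <= t <= 1 ->
    nabla i (fun x => a *: f x + g x) t = a *: nabla i f t + nabla i g t}.
Proof.
move=> sf sg; rewrite leq_eqVlt => /predU1P[->{i}|si]; last first.
  by apply: aeW => t t01; exact: nabla_comb.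
case: s sf sg (@nabla_comb) => [|s'] sf sg nc; first by apply: aeW.
have h1 := sobolev_ae_derivable sf erefl.
have h2 := sobolev_ae_derivable sg erefl.
apply: lebesgue_aeS2 h1 h2 => t h1 h2 t01.
apply: has_deriv01_unique => //.
apply: (@has_deriv01_comb (nabla s' f) (nabla s' g)) => //.
- by move=> x x01; exact: nc.
- by apply: derivable01_has_deriv; exact: h1.
- by apply: derivable01_has_deriv; exact: h2.
Qed.

Lemma sqL2norm_sobolev f i : sobolev s f -> (0 < s)%N -> (i <= s)%N ->
  sqL2norm (nabla i f) = \sum_(c < d) energy (curve_jet f c i).
Proof.
move=> sf s0 si; rewrite /sqL2norm /Rintegral.
under eq_integral do rewrite enorm_sqE -sumEFin.
rewrite ge0_integral_sum//; last 2 first.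
- move=> c; apply/measurable_EFinP; apply: measurable_funX.
  exact: (sobolev_nabla_measurable c sf s0 si).1.
- by move=> c x _; rewrite lee_fin sqr_ge0.
rewrite -[RHS]/(fine (\sum_(c < d) energy (curve_jet f c i))%:E) -sumEFin; congr fine.
apply: eq_bigr => c _; rewrite fineK//; apply: integrable_fin_num => //.
exact: (sobolev_nabla_measurable c sf s0 si).2.
Qed.

(** The derivative of order [s] of a combination is a combination of the
    derivatives only almost everywhere; an upper bound on its norm is available
    without discussing its measurability. *)
Lemma sqL2norm_comb_le f g (a : R) i : sobolev s f -> sobolev s g -> (0 < s)%N -> (i <= s)%N ->
  sqL2norm (nabla i (fun x => a *: f x + g x)) <=
  \sum_(c < d) energy (fun x => a * curve_jet f c i x + curve_jet g c i x).
Proof.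
move=> sf sg s0 si.
have mj c : measurable_fun (`[0, 1]%classic : set R) (fun x => a * curve_jet f c i x + curve_jet g c i x).
  apply: measurable_funD; last exact: (sobolev_nabla_measurable c sg s0 si).1.
  by apply: measurable_funM => //; exact: (sobolev_nabla_measurable c sf s0 si).1.
have ij c : (@lebesgue_measure R).-integrable (`[0, 1]%classic : set R)
    (fun x => ((a * curve_jet f c i x + curve_jet g c i x) ^+ 2)%:E).
  have [m1 i1] := sobolev_nabla_measurable c sf s0 si.
  have [m2 i2] := sobolev_nabla_measurable c sg s0 si.
  exact: sq_integrable_comb.
rewrite /sqL2norm /Rintegral -[leRHS]/(fine (\sum_(c < d) energy (fun x => a * curve_jet f c i x + curve_jet g c i x))%:E).
have key : (\int[@lebesgue_measure R]_(x in `[0%R, 1%R]%classic) (enorm (nabla i (fun x => a *: f x + g x) x) ^+ 2)%:E <=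
   (\sum_(c < d) energy (fun x => a * curve_jet f c i x + curve_jet g c i x))%:E)%E.
  apply: (@le_trans _ _ (\int[@lebesgue_measure R]_(x in `[0%R, 1%R]%classic) (\sum_(c < d) (a * curve_jet f c i x + curve_jet g c i x) ^+ 2)%:E)%E).
    apply: ae_ge0_le_integral_nonmeasurable => //.
    - by move=> x _; rewrite lee_fin sqr_ge0.
    - by move=> x _; rewrite lee_fin sumr_ge0// => c _; exact: sqr_ge0.
    - by apply/measurable_EFinP; apply: measurable_sum => c; exact: measurable_funX (mj c).
    - apply: lebesgue_aeS (nabla_comb_ae a sf sg si) => x h; rewrite /= in_itv/= => x01.
      rewrite h// enorm_sqE lee_fin le_eqVlt; apply/orP; left; apply/eqP.
      by apply: eq_bigr => c _; rewrite !mxE.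
  under eq_integral do rewrite -sumEFin.
  rewrite ge0_integral_sum//; last 2 first.
  - by move=> c; apply/measurable_EFinP; exact: measurable_funX (mj c).
  - by move=> c x _; rewrite lee_fin sqr_ge0.
  rewrite -sumEFin; apply: lee_sum => c _.
  by rewrite fineK//; apply: integrable_fin_num.
apply: fine_le => //.
rewrite ge0_fin_numE; first exact: le_lt_trans key (ltry _).
by apply: integral_ge0 => x _; rewrite lee_fin sqr_ge0.
Qed.

End sobolev_jet.
End derivatives.

(** * Tuples of trajectories *)

Section track_jets.
Variables (R : realType) (d k s : nat).
Hypothesis s_gt0 : (0 < s)%N.
Implicit Types m : tracks R d k.

Definition track_jet m (a : 'I_k.+1 * 'I_d) : nat -> R -> R := curve_jet (m a.1) a.2.

Lemma track_jet_jet m a : sobolev_tracks s m -> jet s (track_jet m a).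
Proof. by move=> sm; exact: sobolev_curve_jet. Qed.

Lemma sum_sqL2norm_energy m i : sobolev_tracks s m -> (i <= s)%N ->
  \sum_(j < k.+1) sqL2norm (nabla i (m j)) = \sum_a energy (track_jet m a i).
Proof.
move=> sm si; rewrite (eq_bigr (fun j => \sum_(c < d) energy (curve_jet (m j) c i))); last first.
  by move=> j _; apply: (sqL2norm_sobolev (s := s)).
by rewrite pair_bigA.
Qed.

Lemma sqL2norm_ge0 (f : R -> 'rV[R]_d) : 0 <= sqL2norm f.
Proof. by apply: Rintegral_ge0 => x _; exact: sqr_ge0. Qed.

Lemma sobolev_norm_sqE m :
  sobolev_norm s m ^+ 2 = \sum_(j < k.+1) \sum_(i < s.+1) sqL2norm (nabla i (m j)).
Proof.
rewrite sqr_sqrtr// sumr_ge0// => j _; rewrite sumr_ge0// => i _; exact: sqL2norm_ge0.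
Qed.

Lemma sobolev_norm_diff_le m m' : sobolev_tracks s m -> sobolev_tracks s m' ->
  sobolev_norm s (fun j x => m j x - m' j x) ^+ 2 <=
  s.+1%:R * 4 ^+ s *
    \sum_a jet_sqnorm s (fun i x => -1 * track_jet m' a i x + track_jet m a i x).
Proof.
move=> sm sm'; rewrite sobolev_norm_sqE exchange_big/= -mulrA -[s.+1 in X in _ <= X]card_ord.
rewrite mulr_natl -sumr_const; apply: ler_sum => i _.
have si : (i <= s)%N by rewrite -ltnS.
rewrite mulr_sumr -(pair_bigA _ (fun j c => 4 ^+ s * jet_sqnorm s
   (fun i x => -1 * track_jet m' (j, c) i x + track_jet m (j, c) i x)))/=.
apply: ler_sum => j _.
have -> : (fun x => m j x - m' j x) = (fun x => -1 *: m' j x + m j x).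
  by apply/funext => x; rewrite scaleN1r addrC.
apply: (le_trans (sqL2norm_comb_le _ (sm' j) (sm j) s_gt0 si)).
apply: ler_sum => c _.
have jj := jet_comb (-1) (track_jet_jet (j, c) sm') (track_jet_jet (j, c) sm).
apply: (le_trans (jet_energy_le jj si)).
by rewrite ler_wpM2r ?jet_sqnorm_ge0// ler_weXn2l ?leq_subr//; lra.
Qed.

(** Sobolev embedding: compare [g t] with [g x] by Hoelder continuity and average
    over [x]. *)
Lemma curve_jet_eval_le (f : R -> 'rV[R]_d) c i t : sobolev s f -> (i < s)%N -> 0 <= t <= 1 ->
  curve_jet f c i t ^+ 2 <= 2 * energy (curve_jet f c i) + 2 * energy (curve_jet f c i.+1).
Proof.
move=> sf si /andP[t0 t1]; have p := sobolev_curve_jet c sf si.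
have [mg ig] := primitive_measurable_sq p.
set g := curve_jet f c i in p mg ig *; set E := energy _ in p *.
set v := curve_jet f c i.+1 in p *; have E0 := energy_ge0 v.
suff : g t ^+ 2 / 2 - energy v <= energy g by rewrite /E; lra.
have -> : g t ^+ 2 / 2 - energy v =
    \int[@lebesgue_measure R]_(x in `[0, 1]%classic) (g t ^+ 2 / 2 - energy v).
  by rewrite Rintegral_cst_itv// subr0 mulr1.
apply: le_Rintegral => //; first exact: integrable_cst_itv.
move=> x; rewrite /= in_itv/= => /andP[x0 x1].
suff h : (g t - g x) ^+ 2 <= energy v by have := sqr_ge0 (g t - 2 * g x); nra.
have [tx|xt] := leP t x.
  rewrite -sqrrN opprB; apply: (le_trans (primitive_holder p t0 tx x1)).
  by apply: ler_piMl => //; lra.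
apply: (le_trans (primitive_holder p x0 (ltW xt) t1)).
by apply: ler_piMl => //; lra.
Qed.

Lemma eval_bounded_functional a i t : (i < s)%N -> 0 <= t <= 1 ->
  bounded_functional s (fun m => track_jet m a i t).
Proof.
move=> si t01; split.
  move=> b m1 m2 s1 s2; rewrite /track_jet /curve_jet.
  by rewrite (@nabla_comb _ _ s)// !mxE.
exists 2 => m sm; have N0 : 0 <= sobolev_norm s m by exact: sqrtr_ge0.
rewrite -ler_sqr ?nnegrE ?mulr_ge0// real_normK ?num_real// exprMn.
have le1 i' : (i' <= s)%N -> energy (track_jet m a i') <= sobolev_norm s m ^+ 2.
  move=> si'; rewrite sobolev_norm_sqE.
  have -> : \sum_(j < k.+1) \sum_(i0 < s.+1) sqL2norm (nabla i0 (m j)) =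
      \sum_(i0 < s.+1) \sum_a energy (track_jet m a i0).
    by rewrite exchange_big; apply: eq_bigr => i0 _; apply: sum_sqL2norm_energy; rewrite // -ltnS.
  have ilt : (i' < s.+1)%N by [].
  rewrite (bigD1 (Ordinal ilt))//= (bigD1 a)//= -addrA lerDl addr_ge0//.
    by apply: sumr_ge0 => b _; exact: energy_ge0.
  by apply: sumr_ge0 => i0 _; apply: sumr_ge0 => b _; exact: energy_ge0.
apply: (le_trans (curve_jet_eval_le a.2 (sm a.1) si t01)).
have := le1 i (ltnW si); have := le1 i.+1 si; rewrite /track_jet; lra.
Qed.

Lemma weak_cvg_track_jet (m_ : nat -> tracks R d k) m a i t : weak_cvg s m_ m ->
  (i < s)%N -> 0 <= t <= 1 -> track_jet (m_ n) a i t @[n --> \oo] --> track_jet m a i t.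
Proof. by move=> [_ h] si t01; exact: (h _ (eval_bounded_functional a si t01)). Qed.

Lemma Theta_weak_closed (delta : R) (m_ : nat -> tracks R d k) m :
  0 < delta -> weak_cvg s m_ m -> (\forall n \near \oo, Theta s delta (m_ n)) ->
  Theta s delta m.
Proof.
move=> delta0 wm Tm; split; first exact: wm.1.
move=> t t01 j l jl.
rewrite -ler_sqr ?nnegrE ?sqrtr_ge0 ?(ltW delta0)// enorm_sqE.
have : \sum_(c < d) (m_ n j t - m_ n l t) ord0 c ^+ 2 @[n --> \oo] -->
    \sum_(c < d) (m j t - m l t) ord0 c ^+ 2.
  apply: (cvg_big (op := +%R)) => [|c _]; first exact: add_continuous.
  have cj j' : m_ n j' t ord0 c @[n --> \oo] --> m j' t ord0 c.
    exact: (@weak_cvg_track_jet m_ m (j', c) 0%N t wm s_gt0 t01).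
  have cd : (m_ n j t - m_ n l t) ord0 c @[n --> \oo] --> (m j t - m l t) ord0 c.
    by under eq_fun do rewrite !mxE; rewrite !mxE; apply: cvgB; exact: cj.
  by under eq_fun do rewrite expr2; rewrite expr2; apply: cvgM.
move=> /cvgr_to_ge; apply; near=> n.
rewrite -enorm_sqE ler_sqr ?nnegrE ?sqrtr_ge0 ?(ltW delta0)//.
have [_ h] : Theta s delta (m_ n) by near: n.
exact: h.
Unshelve. all: by end_near. Qed.

(** A competitor in [Theta]: constant curves along the diagonal of R^d, the curve
    of index 0 being zero. *)
Definition constant_tracks (delta : R) : tracks R d k :=
  fun j _ => const_mx (delta * j%:R).

Lemma has_deriv01_const (f : R -> 'rV[R]_d) v t : 0 <= t <= 1 ->
  (forall x, 0 <= x <= 1 -> f x = v) -> has_deriv01 f t 0.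
Proof.
move=> t01 fv; have FF := increments01_filter t.
have : (0 : 'rV[R]_d) @[h --> increments01 t] --> (0 : 'rV[R]_d) by exact: cvg_cst.
apply: cvg_trans; apply: near_eq_cvg; rewrite /increments01 near_withinE.
by apply: nearW => h /= th; rewrite /diff_quot !fv// subrr scaler0.
Qed.

Lemma nabla_const (v : 'rV[R]_d) i t : 0 <= t <= 1 ->
  nabla i (fun=> v) t = if i == 0%N then v else 0.
Proof.
elim: i t => // i ih t t01.
by apply: has_deriv01_unique => //; exact: (has_deriv01_const (v := if i == 0%N then v else 0)).
Qed.

Lemma sobolev_const (v : 'rV[R]_d) : sobolev s (fun=> v).
Proof.
have dv i t : 0 <= t <= 1 -> derivable01 (nabla i (fun=> v)) t.
  move=> t01; apply/cvg_ex; exists 0.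
  apply: (has_deriv01_const (v := if i == 0%N then v else 0)) => // x.
  exact: nabla_const.
have cE i x : x \in (`[0, 1]%classic : set R) -> nabla i (fun=> v) x = (if i == 0%N then v else 0).
  by rewrite inE/= in_itv/=; exact: nabla_const.
split.
- by move=> i _; exact: dv.
- by move=> i _; apply: aeW => t; exact: dv.
- move=> i _ e e0; exists 1 => // n a b ab _ _; rewrite big1// => j _.
  have [? [? ?]] := ab j.
  rewrite !nabla_const; [|lra|lra].
  by rewrite subrr /enorm big1 ?sqrtr0// => c _; rewrite mxE expr0n.
- split.
    apply: (eq_measurable_fun (cst (if s == 0%N then v else 0))); last exact: measurable_cst.
    by move=> x xI; rewrite cE.
  rewrite (eq_integral (cst (enorm (if s == 0%N then v else 0) ^+ 2)%:E)); last first.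
    by move=> x xI; rewrite /= cE.
  rewrite integral_cst//; apply: lte_mul_pinfty; rewrite ?lee_fin ?sqr_ge0//.
  change (@lebesgue_measure R `[0%R, 1%R]%classic < +oo)%E.
  by rewrite lebesgue_measure_itv/= lte01 sube0 ltry.
Qed.

Lemma constant_tracks_Theta (delta : R) : (0 < d)%N -> 0 < delta ->
  Theta s delta (constant_tracks delta).
Proof.
move=> d0 delta0; split; first by move=> j; exact: sobolev_const.
move=> t t01 j l jl.
apply: le_trans (coord_le_enorm _ (Ordinal d0)); rewrite !mxE -mulrBr normrM gtr0_norm//.
rewrite ler_peMr ?(ltW delta0)//.
wlog lj : j l jl / (l < j)%N.
  move=> h; have [|] := ltnP l j; first exact: h.
  rewrite leq_eqVlt => /predU1P[e|]; first by case/eqP: jl; exact: val_inj.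
  by rewrite distrC; apply: h; rewrite eq_sym.
rewrite -natrB ?(ltnW lj)// normr_nat ler1n subn_gt0//.
Qed.

Lemma constant_tracks_energy (delta : R) a : energy (track_jet (constant_tracks delta) a s) = 0.
Proof.
rewrite /energy (@eq_Rintegral _ _ _ _ _ (cst 0)); last first.
  move=> x; rewrite inE/= in_itv/= => x01.
  by rewrite /track_jet /curve_jet nabla_const// eqn0Ngt s_gt0/= mxE expr0n.
by rewrite Rintegral_cst_itv// mul0r.
Qed.

End track_jets.

(** * Minimizers for a fixed outcome *)

Section pathwise.
Variables (R : realType) (d k s : nat).
Implicit Types m : tracks R d k.

Lemma min_sqdist_le m t y j : min_sqdist m t y <= enorm (y - m j t) ^+ 2.
Proof. by rewrite /min_sqdist; exact: bigmin_le_cond. Qed.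

Lemma min_sqdist_attained m t y : exists j, min_sqdist m t y = enorm (y - m j t) ^+ 2.
Proof.
rewrite /min_sqdist; elim/big_ind: _ => [|a b [j ->] [l ->]|j _].
- by exists ord0.
- by rewrite /Num.min; case: ifP => _; [exists j|exists l].
- by exists j.
Qed.

Lemma min_sqdist_ge0 m t y : 0 <= min_sqdist m t y.
Proof. by have [j ->] := min_sqdist_attained m t y; exact: sqr_ge0. Qed.

Lemma young_sq (eta a b : R) : 0 < eta ->
  (a + b) ^+ 2 <= (1 + eta) * a ^+ 2 + (1 + eta^-1) * b ^+ 2.
Proof.
move=> e0; rewrite -subr_ge0.
have -> : (1 + eta) * a ^+ 2 + (1 + eta^-1) * b ^+ 2 - (a + b) ^+ 2 =
    eta * (a - eta^-1 * b) ^+ 2 by field; rewrite gt_eqF.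
by rewrite mulr_ge0 ?sqr_ge0// ltW.
Qed.

(** The multiplicative form of the error lets a bound on the mean of
    [min_sqdist m] suffice when the observations are averaged. *)
Lemma min_sqdist_perturb m m' t y (eta r : R) : 0 < eta ->
  (forall j c, (m j t ord0 c - m' j t ord0 c) ^+ 2 <= r) ->
  min_sqdist m' t y <= (1 + eta) * min_sqdist m t y + (1 + eta^-1) * (d%:R * r).
Proof.
move=> eta0 mm'; have [j ->] := min_sqdist_attained m t y.
apply: (le_trans (min_sqdist_le m' t y j)).
rewrite !enorm_sqE mulr_sumr.
have -> : (1 + eta^-1) * (d%:R * r) = \sum_(c < d) (1 + eta^-1) * r.
  by rewrite sumr_const card_ord -[RHS]mulr_natl; ring.
rewrite -big_split/=; apply: ler_sum => c _; rewrite !mxE.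
have -> : y ord0 c - m' j t ord0 c =
  (y ord0 c - m j t ord0 c) + (m j t ord0 c - m' j t ord0 c) by ring.
apply: (le_trans (young_sq _ _ eta0)); rewrite lerD2l.
by apply: ler_wpM2l => //; rewrite addr_ge0// invr_ge0 ltW.
Qed.

Variables (lambda delta : R) (t : nat -> R) (y : nat -> 'rV[R]_d).
Hypothesis s_gt0 : (0 < s)%N.
Hypothesis d_gt0 : (0 < d)%N.
Hypothesis lambda_gt0 : 0 < lambda.
Hypothesis delta_gt0 : 0 < delta.
Hypothesis t01 : forall i, 0 <= t i <= 1.

Definition mean_sq (n : nat) : R := n%:R^-1 * \sum_(i < n) enorm (y i) ^+ 2.

Definition tracks_energy m : R := \sum_a energy (track_jet m a s).

Lemma regularizer_energy m : sobolev_tracks s m ->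
  regularizer s lambda m = lambda * tracks_energy m.
Proof. by move=> sm; rewrite /regularizer (@sum_sqL2norm_energy _ _ _ s). Qed.

(** The curve of index 0 vanishes, so the distance to it is the norm of the
    observation. *)
Lemma f_n_constant_le n : f_n s lambda t y n (@constant_tracks R d k delta) <= mean_sq n.
Proof.
rewrite /f_n regularizer_energy; last by move=> j; exact: sobolev_const.
have -> : tracks_energy (@constant_tracks R d k delta) = 0.
  by rewrite /tracks_energy big1// => a _; exact: constant_tracks_energy.
rewrite mulr0 addr0.
apply: ler_wpM2l; first by rewrite invr_ge0.
apply: ler_sum => i _; apply: (le_trans (min_sqdist_le _ _ _ ord0)).
by rewrite /constant_tracks mulr0 subr0.
Qed.

Definition track_jet_diff m m' a i x : R := -1 * track_jet m' a i x + track_jet m a i x.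

(** Minimality is used twice: against the constant curves, to bound the energy
    and the data term of [mu l] by [M], and against the limit [muoo], to bound
    the energy of [mu l] by that of [muoo] up to an error. The error consists of a
    multiple [eta] of the data term of [mu l] and of [C] times the squared
    uniform distance; [eta] and the bound [r] on that square are chosen to make
    each part at most [lambda * e / 2]. *)
Lemma minimizers_strong_cvg (n_ : nat -> nat) (mu : nat -> tracks R d k) muoo (M : R) :
  (forall l, (0 < n_ l)%N) ->
  (forall l, minimizes (Theta s delta) (f_n s lambda t y (n_ l)) (mu l)) ->
  weak_cvg s mu muoo -> 0 < M -> forall e, 0 < e ->
  \forall l \near \oo, mean_sq (n_ l) <= M ->
    \sum_a jet_sqnorm s (track_jet_diff (mu l) muoo a) <= e.
Proof.
move=> n0 mumin wmu M0.
have Too : Theta s delta muoo.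
  by apply: Theta_weak_closed wmu _ => //; apply: nearW => l; exact: (mumin l).1.
have sob l : sobolev_tracks s (mu l) by exact: (mumin l).1.1.
have soboo : sobolev_tracks s muoo := Too.1.
have ptw a i x : (i < s)%N -> 0 <= x <= 1 ->
    track_jet (mu l) a i x @[l --> \oo] --> track_jet muoo a i x.
  exact: weak_cvg_track_jet.
have jl l a := track_jet_jet a (sob l).
have joo a := track_jet_jet a soboo.
pose avg l m := (n_ l)%:R^-1 * \sum_(i < n_ l) min_sqdist m (t i) (y i).
have avg0 l m : 0 <= avg l m.
  by rewrite mulr_ge0 ?invr_ge0// sumr_ge0// => i _; exact: min_sqdist_ge0.
have en0 m : 0 <= tracks_energy m by apply: sumr_ge0 => a _; exact: energy_ge0.
have fE l m : sobolev_tracks s m -> f_n s lambda t y (n_ l) m = avg l m + lambda * tracks_energy m.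
  by move=> sm; rewrite /f_n regularizer_energy.
have fM l : mean_sq (n_ l) <= M -> avg l (mu l) + lambda * tracks_energy (mu l) <= M.
  move=> hM; rewrite -fE//; apply: le_trans hM; apply: le_trans (f_n_constant_le _).
  by apply: (mumin l).2; exact: constant_tracks_Theta.
apply: (energy_limsup_strong_cvg s_gt0 jl joo ptw (P := fun l => mean_sq (n_ l) <= M)) => e e0.
pose eta := lambda * e / (2 * M).
have eta0 : 0 < eta by rewrite divr_gt0 ?mulr_gt0.
pose C := (1 + eta^-1) * d%:R.
have C0 : 0 < C by rewrite mulr_gt0 ?ltr0n// addr_gt0 ?invr_gt0.
pose r := lambda * e / (2 * C).
have r0 : 0 < r by apply: divr_gt0; apply: mulr_gt0.
have := bounded_energy_uniform_cvg s_gt0 jl joo ptw (M / lambda) r0.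
apply: filterS => l hl hM.
have fMl := fM _ hM.
have enM : tracks_energy (mu l) <= M / lambda.
  by rewrite ler_pdivlMr// mulrC; have := avg0 l (mu l); lra.
have {}hl := hl (fun a => le_trans _ enM) .
have diff a x : 0 <= x <= 1 -> (track_jet (mu l) a 0%N x - track_jet muoo a 0%N x) ^+ 2 <= r.
  move=> x01; rewrite (_ : _ - _ = -1 * track_jet muoo a 0%N x + track_jet (mu l) a 0%N x); last by ring.
  apply: hl => // b; rewrite /tracks_energy (bigD1 b)//= lerDl sumr_ge0// => c _; exact: energy_ge0.
have avgle : avg l muoo <= (1 + eta) * avg l (mu l) + C * r.
  rewrite /avg; apply: (@le_trans _ _ ((n_ l)%:R^-1 * \sum_(i < n_ l) ((1 + eta) * min_sqdist (mu l) (t i) (y i) + C * r))).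
    apply: ler_wpM2l; first by rewrite invr_ge0.
    apply: ler_sum => i _; rewrite /C -mulrA; apply: min_sqdist_perturb => // j c.
    exact: (diff (j, c)).
  rewrite big_split/= -mulr_sumr sumr_const card_ord mulrDr mulrCA lerD2l.
  by rewrite -[C * r *+ _]mulr_natl mulrA mulVf ?mul1r// pnatr_eq0 -lt0n.
have := (mumin l).2 _ Too; rewrite !fE//.
have h1 : eta * avg l (mu l) <= lambda * e / 2.
  apply: (@le_trans _ _ (eta * M)).
    apply: ler_wpM2l; [exact: ltW|].
    by have := mulr_ge0 (ltW lambda_gt0) (en0 (mu l)); lra.
  by rewrite /eta le_eqVlt; apply/orP; left; apply/eqP; field; rewrite gt_eqF.
have h2 : C * r = lambda * e / 2 by rewrite /r; field; rewrite gt_eqF.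
move=> h3; rewrite -(ler_pM2l lambda_gt0) mulrDr -/(tracks_energy _) -/(tracks_energy _).
by lra.
Qed.

End pathwise.

(** * Measurability in the outcome *)

Section measurability.
Context {disp : measure_display} {Omega : measurableType disp} {R : realType}.

Lemma slope_quotient_cvg (g : R -> R) (t l : R) (x : nat -> R) : slope g t l ->
  (forall n, 0 <= x n <= 1) -> (forall n, x n != t) -> x n @[n --> \oo] --> t ->
  (x n - t)^-1 * (g (x n) - g t) @[n --> \oo] --> l.
Proof.
move=> s x01 xt xcvg; apply/cvgrPdist_le => e e0; have [r r0 h] := s _ e0.
move/cvgrPdist_lt : xcvg => /(_ _ r0); apply: filterS => n; rewrite distrC => xr.
have := h _ (x01 n) xr; set z := x n - t => hz.
have z0 : z != 0 by rewrite subr_eq0.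
have -> : l - z^-1 * (g (x n) - g t) = - (z^-1 * (g (x n) - g t - l * z)) by field.
by rewrite normrN normrM normfV ler_pdivrMl ?normr_gt0// [_ * e]mulrC.
Qed.

(** A sequence in [0,1] converging to [t] from the side on which there is room. *)
Definition approach (t : R) (n : nat) : R :=
  if t <= 1 / 2 then t + n.+2%:R^-1 else t - n.+2%:R^-1.

Lemma approach_spec (t : R) : 0 <= t <= 1 ->
  [/\ forall n, 0 <= approach t n <= 1, forall n, approach t n != t &
      approach t n @[n --> \oo] --> t].
Proof.
move=> /andP[t0 t1].
have i0 n : 0 < n.+2%:R^-1 :> R by rewrite invr_gt0.
have i2 n : n.+2%:R^-1 <= 1 / 2 :> R by rewrite div1r lef_pV2 ?posrE// ler_nat.
split.
- move=> n; have := i0 n; have := i2 n; set q := n.+2%:R^-1.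
  by move=> ? ?; rewrite /approach -/q; have [?|?] := leP t (1 / 2); lra.
- move=> n; have := i0 n; rewrite /approach; set q := n.+2%:R^-1 => q0.
  by case: leP => _; rewrite -subr_eq0 addrAC subrr add0r ?oppr_eq0 gt_eqF.
- have h0 : n.+2%:R^-1 @[n --> \oo] --> (0 : R).
    by have := @cvg_harmonic R; rewrite -cvg_shiftS.
  rewrite /approach; case: leP => _.
    by rewrite -[X in _ --> X]addr0; apply: cvgD => //; exact: cvg_cst.
  by rewrite -[X in _ --> X]subr0; apply: cvgB => //; exact: cvg_cst.
Qed.

Variables (D : set Omega) (d k s : nat).
Hypothesis s_gt0 : (0 < s)%N.

(** Derivatives are limits of difference quotients along a fixed sequence, and
    those are measurable by induction on the order. *)
Lemma measurable_track_jet (m : Omega -> tracks R d k) a i t : random_tracks m ->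
  (forall w, D w -> sobolev_tracks s (m w)) -> (i < s)%N -> 0 <= t <= 1 ->
  measurable_fun D (fun w => track_jet (m w) a i t).
Proof.
move=> rm sm; elim: i t => [|i ih] t si t01.
  apply: (measurable_funS measurableT) => //.
  exact: (measurableT_comp (@measurable_coord _ R d a.2) (rm a.1 t t01)).
have [x01 xt xcvg] := approach_spec t01.
have si' : (i < s)%N by exact: ltnW.
apply: (@measurable_fun_cvg _ _ _ _ (fun n w => (approach t n - t)^-1 *
    (track_jet (m w) a i (approach t n) - track_jet (m w) a i t))).
  move=> n; apply: measurable_funM; first exact: measurable_cst.
  by apply: measurable_funB; exact: ih.
move=> w Dw; apply: (slope_quotient_cvg _ x01 xt xcvg).
apply: has_deriv01_slope => //; apply: derivable01_has_deriv.
exact: (sobolev_derivable (sm w Dw a.1)).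
Qed.

Lemma measurable_track_jet_limit (m_ : nat -> Omega -> tracks R d k) moo a i t :
  (forall n, random_tracks (m_ n)) -> (forall n w, D w -> sobolev_tracks s (m_ n w)) ->
  (forall w, D w -> weak_cvg s (m_ ^~ w) (moo w)) -> (i < s)%N -> 0 <= t <= 1 ->
  measurable_fun D (fun w => track_jet (moo w) a i t).
Proof.
move=> rm sm wm si t01.
apply: (@measurable_fun_cvg _ _ _ _ (fun n w => track_jet (m_ n w) a i t)).
  by move=> n; apply: measurable_track_jet => //; exact: sm.
by move=> w Dw; exact: (@weak_cvg_track_jet _ _ _ _ s_gt0 (m_^~ w) (moo w) a i t (wm w Dw) si t01).
Qed.

Lemma measurable_jet_sqnorm (J : Omega -> nat -> R -> R) :
  (forall w, D w -> jet s (J w)) ->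
  (forall i t, (i < s)%N -> 0 <= t <= 1 -> measurable_fun D (fun w => J w i t)) ->
  measurable_fun D (fun w => jet_sqnorm s (J w)).
Proof.
move=> jJ mJ; have s1 : (s.-1 < s)%N by rewrite prednK.
apply: measurable_funD.
  by apply: measurable_sum => i; apply: measurable_funX; apply: mJ; rewrite // lexx ler01.
apply: (@measurable_fun_cvg _ _ _ _ (fun n w => discrete_energy n (J w s.-1))).
  move=> n; apply: measurable_funM; first exact: measurable_cst.
  apply: measurable_sum => l; apply: measurable_funX; apply: measurable_funB; apply: mJ => //;
    by rewrite node_ge0 node_le1// ltnW.
move=> w Dw; rewrite -[in X in _ --> X](prednK s_gt0).
exact: discrete_energy_cvg (jJ w Dw _ s1).
Qed.

End measurability.

(** * Moments of the data *)

Section moments.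
Context {disp : measure_display} {Omega : measurableType disp} {R : realType}.
Variable P : probability Omega R.

(** Cut along the shells [k <= h < k.+1], on which [h] is at most [k.+1] and
    [k.+1] at most [h + 1]; the loss of 1 replaces the change of variables by the
    defining property of the density. *)
Lemma density_integral_le d' (T : measurableType d') (X : {RV P >-> T})
    (nu : {measure set T -> \bar R}) (f h : T -> R) :
  has_density P X nu setT f -> measurable_fun setT h -> (forall x, 0 <= h x) ->
  (\int[P]_w (h (X w))%:E <= \int[nu]_x ((h x + 1) * f x)%:E)%E.
Proof.
move=> [mf f0 PX] mh h0.
pose A k := h @^-1` `[k%:R, k.+1%:R[%classic.
have mA k : measurable (A k) by rewrite -[A k]setTI; exact: mh.
have hA x : exists k, A k x.
  by have /andP[t1 t2] := truncn_itv (h0 x); exists (Num.truncn (h x)); rewrite /A/= in_itv/= t1.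
have UA : \bigcup_k A k = setT.
  by apply/seteqP; split => // x _; have [k Ak] := hA x; exists k.
have tA : trivIset setT A.
  apply/trivIsetP => i j _ _ ij; apply/seteqP; split => // x [].
  rewrite /A/= !in_itv/= => /andP[i1 i2] /andP[j1 j2]; move/eqP: ij; apply.
  apply/eqP; rewrite eqn_leq -ltnS -(ltr_nat R) (le_lt_trans i1 j2)/=.
  by rewrite -ltnS -(ltr_nat R) (le_lt_trans j1 i2).
have mX k : measurable (X @^-1` A k) by exact: measurable_funPTI.
have UX : \bigcup_k (X @^-1` A k) = setT by rewrite -preimage_bigcup UA.
have tX : trivIset setT (fun k => X @^-1` A k).
  apply/trivIsetP => i j _ _ ij; move/trivIsetP : tA => /(_ i j I I ij) Aij.
  by rewrite -preimage_setI Aij preimage_set0.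
have mhX : measurable_fun setT (fun w => (h (X w))%:E).
  by apply/measurable_EFinP; exact: measurableT_comp.
have mhf : measurable_fun setT (fun x => ((h x + 1) * f x)%:E).
  by apply/measurable_EFinP/measurable_funM => //; exact: measurable_funD.
have g0 x : (0 <= ((h x + 1) * f x)%:E)%E.
  by rewrite lee_fin mulr_ge0 ?f0// addr_ge0.
rewrite -UX ge0_integral_bigcup//; last 2 first.
- by rewrite UX.
- by move=> w _; rewrite lee_fin.
rewrite -[in leRHS]UA ge0_integral_bigcup//; last by rewrite UA.
apply: lee_nneseries => [k _ _|k _].
  by apply: integral_ge0 => w _; rewrite lee_fin.
apply: (@le_trans _ _ (\int[P]_(w in X @^-1` A k) (cst k.+1%:R%:E) w)%E).
  apply: ge0_le_integral => //.
  - by move=> w _; rewrite lee_fin.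
  - exact: measurable_funS mhX.
  - by move=> w; rewrite /A/= in_itv/= lee_fin => /andP[_ /ltW].
rewrite integral_cst//; change (k.+1%:R%:E * P (X @^-1` A k) <=
  \int[nu]_(x in A k) ((h x + 1) * f x)%:E)%E.
rewrite PX// setTI -ge0_integralZl//; last 2 first.
- by apply/measurable_EFinP; exact: measurable_funS mf.
- by move=> x _; rewrite lee_fin f0.
apply: ge0_le_integral => //.
- by move=> x _; rewrite -EFinM lee_fin mulr_ge0 ?f0.
- apply: measurable_funeM; apply/measurable_EFinP; exact: measurable_funS mf.
- exact: measurable_funS mhf.
- move=> x; rewrite /A/= in_itv/= => /andP[k1 _]; rewrite -EFinM lee_fin ler_wpM2r ?f0//.
  by rewrite -natr1 lerD2r.
Qed.

Lemma density_null_set d' (T : measurableType d') (X : {RV P >-> T})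
    (nu : {measure set T -> \bar R}) (E N : set T) (f : T -> R) :
  measurable E -> has_density P X nu E f -> measurable N -> nu N = 0%E ->
  P (X @^-1` N) = 0%E.
Proof.
move=> mE [mf f0 PX] mN nuN; rewrite PX//.
apply: null_set_integral => //; first exact: measurableI.
  by apply/measurable_EFinP; apply: measurable_funS mf.
apply/eqP; rewrite eq_le measure_ge0 andbT -[leRHS]nuN.
by apply: le_measure; rewrite ?inE//; exact: measurableI.
Qed.

(** Lebesgue measure on the line with its default structure of measurable type,
    the one that real random variables take their values in. *)
Definition lebesgue_borel : set R -> \bar R := @lebesgue_measure R.

Let lebesgue_borel0 : lebesgue_borel set0 = 0%E.
Proof. exact: (@measure0 _ _ _ (@lebesgue_measure R)). Qed.

Let lebesgue_borel_ge0 A : (0 <= lebesgue_borel A)%E.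
Proof. exact: (@measure_ge0 _ _ _ (@lebesgue_measure R)). Qed.

Let lebesgue_borel_sigma_additive : semi_sigma_additive lebesgue_borel.
Proof. exact: (@measure_semi_sigma_additive _ _ _ (@lebesgue_measure R)). Qed.

HB.instance Definition _ := isMeasure.Build _ R R lebesgue_borel
  lebesgue_borel0 lebesgue_borel_ge0 lebesgue_borel_sigma_additive.

Lemma density01_negligible (X : {RV P >-> R}) (f : R -> R) (Q : R -> Prop) :
  has_density P X (@lebesgue_measure R) `[0, 1]%classic f ->
  {ae @lebesgue_measure R, forall x, Q x} -> {ae P, forall w, Q (X w)}.
Proof.
move=> hX [N [mN muN QN]].
exists (X @^-1` N); split => //.
- exact: (measurable_funPTI X mN).
- exact: (@density_null_set _ _ X lebesgue_borel _ N f (measurable_itv _) hX mN muN).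
- by move=> w nQ; exact: QN.
Qed.

Lemma enorm_sqD_le d (u v : 'rV[R]_d) :
  enorm (u + v) ^+ 2 <= 2 * enorm u ^+ 2 + 2 * enorm v ^+ 2.
Proof.
rewrite !enorm_sqE !mulr_sumr -big_split/=; apply: ler_sum => c _; rewrite !mxE.
by have := sqr_ge0 (u ord0 c - v ord0 c); nra.
Qed.

Variables (d k : nat).
Variables (mudag : tracks R d k) (p : 'I_k.+1 -> R).
Variables (phi0 : 'rV[R]_d -> R) (phiT : R -> R).
Variables (phi : nat -> {RV P >-> 'I_k.+1}) (eps : nat -> {RV P >-> 'rV[R]_d}).
Variables (t : nat -> {RV P >-> R}) (y : nat -> {RV P >-> 'rV[R]_d}).

Lemma second_moment_bounded : assumption1 mudag p phi0 phiT phi eps t y ->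
  assumption2 phi0 ->
  exists2 C : R, 0 <= C & forall i, (\int[P]_w (enorm (y i w) ^+ 2)%:E <= C%:E)%E.
Proof.
move=> A1 [_ A2].
have /choice[K hK] := fun j => (a1_Linfty A1 j).2.
pose B := \sum_j `|K j|.
have B0 : 0 <= B by apply: sumr_ge0.
have KB j : K j <= B.
  rewrite (le_trans (ler_norm _))// /B (bigD1 j)//= lerDl sumr_ge0//.
have [mf f0 Peps] := a1_eps A1 0%N.
have mh : measurable_fun setT (fun x : 'rV[R]_d => enorm x ^+ 2).
  by apply: measurable_enorm_sq.
have h0 (x : 'rV[R]_d) : 0 <= enorm x ^+ 2 by exact: sqr_ge0.
set I2 := (\int[lebesgue_row R d]_x (enorm x ^+ 2 * phi0 x)%:E)%E in A2.
have I2fin : I2 \is a fin_num.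
  by rewrite ge0_fin_numE//; apply: integral_ge0 => x _; rewrite lee_fin mulr_ge0// f0.
have S_le : (\int[lebesgue_row R d]_x ((enorm x ^+ 2 + 1) * phi0 x)%:E = I2 + 1)%E.
  under eq_integral do rewrite mulrDl mul1r EFinD.
  rewrite ge0_integralD//.
  - by congr (_ + _)%E; have := Peps _ measurableT; rewrite setTI preimage_setT probability_setT => <-.
  - by move=> x _; rewrite lee_fin mulr_ge0// f0.
  - by apply/measurable_EFinP; exact: measurable_funM.
  - exact/measurable_EFinP.
exists (2 * B ^+ 2 + 2 * (fine I2 + 1)).
  rewrite addr_ge0 ?mulr_ge0 ?sqr_ge0// addr_ge0// fine_ge0//.
  by apply: integral_ge0 => x _; rewrite lee_fin mulr_ge0// f0.
move=> i.
have aeK : {ae P, forall w, forall j, enorm (mudag j (t i w)) <= B}.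
  have h j : {ae P, forall w, enorm (mudag j (t i w)) <= B}.
    have := density01_negligible (a1_t A1 i) (hK j).
    apply: filterS => w.
    by move=> /(_ (a1_t01 A1 i w)) /le_trans; apply.
  have FF := ae_filter_ringOfSetsType P.
  exact: (filter_forall FF h).
have my (X : {RV P >-> 'rV[R]_d}) : measurable_fun setT (fun w => (enorm (X w) ^+ 2)%:E).
  by apply/measurable_EFinP; apply: measurable_enorm_sq.
apply: (@le_trans _ _ (\int[P]_w ((2 * B ^+ 2)%:E + 2%:E * (enorm (eps i w) ^+ 2)%:E))%E).
  apply: ae_ge0_le_integral => //.
  - by move=> w _; rewrite lee_fin sqr_ge0.
  - by move=> w _; rewrite -EFinM -EFinD lee_fin addr_ge0// mulr_ge0// sqr_ge0.
  - apply: emeasurable_funD; first exact: measurable_cst.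
    exact: measurable_funeM.
  - have aem := a1_model A1 i.
    apply: filterS2 aeK aem => w hw yw _; rewrite -EFinM -EFinD lee_fin yw.
    apply: (le_trans (enorm_sqD_le _ _)); rewrite lerD2r ler_wpM2l//.
    by rewrite ler_sqr ?nnegrE ?sqrtr_ge0.
rewrite ge0_integralD//; last 3 first.
- by move=> w _; rewrite lee_fin mulr_ge0// sqr_ge0.
- by move=> w _; rewrite -EFinM lee_fin mulr_ge0.
- exact: measurable_funeM.
rewrite [leRHS]EFinD; apply: leeD.
  rewrite (eq_integral (cst (2 * B ^+ 2)%:E))// integral_cst//.
  by change ((2 * B ^+ 2)%:E * P setT <= (2 * B ^+ 2)%:E)%E; rewrite probability_setT mule1.
rewrite ge0_integralZl//; last by move=> w _; rewrite lee_fin sqr_ge0.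
rewrite EFinM; apply: lee_wpmul2l => //; rewrite EFinD fineK// -S_le.
exact: density_integral_le (a1_eps A1 i) mh h0.
Qed.

Lemma measurable_mean_sq n : measurable_fun setT (fun w => mean_sq (fun i => y i w) n).
Proof.
apply: measurable_funM; first exact: measurable_cst.
by apply: measurable_sum => i; apply: measurable_enorm_sq.
Qed.

(** Markov's inequality. *)
Lemma mean_sq_tight (C : R) n (M : R) : (0 < n)%N -> 0 < M -> 0 <= C ->
  (forall i, (\int[P]_w (enorm (y i w) ^+ 2)%:E <= C%:E)%E) ->
  (P [set w | (M <= mean_sq (fun i => y i w) n)%R] <= (C / M)%:E)%E.
Proof.
move=> n0 M0 C0 hC; set A := [set w | _].
have ms0 w : 0 <= mean_sq (fun i => y i w) n.
  by rewrite mulr_ge0 ?invr_ge0// sumr_ge0// => i _; exact: sqr_ge0.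
have mm : measurable_fun setT (fun w => (mean_sq (fun i => y i w) n)%:E).
  by apply/measurable_EFinP; exact: measurable_mean_sq.
have my (X : {RV P >-> 'rV[R]_d}) : measurable_fun setT (fun w => (enorm (X w) ^+ 2)%:E).
  by apply/measurable_EFinP; apply: measurable_enorm_sq.
have := le_integral_abse P measurableT mm M0.
rewrite setTI (_ : [set x | _] = A); last first.
  by apply/seteqP; split => w /=; rewrite lee_fin ger0_norm.
move=> h; rewrite mulrC EFinM -lee_pdivrMl ?invr_gt0//; rewrite invrK; apply: (le_trans h).
under eq_integral do rewrite gee0_abs ?lee_fin// EFinM -sumEFin.
rewrite ge0_integralZl//; last 2 first.
- by apply: emeasurable_sum => i; exact: my.
- by move=> w _; apply: sume_ge0 => i _; rewrite lee_fin sqr_ge0.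
rewrite ge0_integral_sum//; last by move=> i w _; rewrite lee_fin sqr_ge0.
apply: (@le_trans _ _ (n%:R^-1%:E * \sum_(i < n) C%:E)%E).
  by apply: lee_wpmul2l; [rewrite lee_fin invr_ge0|apply: lee_sum => i _; exact: hC].
rewrite sumEFin -EFinM lee_fin sumr_const card_ord -[C *+ n]mulr_natl mulrA mulVf ?mul1r//.
by rewrite pnatr_eq0 -lt0n.
Qed.

End moments.

(** * Convergence in probability *)

Section convergence_in_probability.
Context {disp : measure_display} {Omega : measurableType disp} {R : realType}.
Variable P : probability Omega R.

Lemma eventually_le_cvg0 (u : nat -> \bar R) : (forall l, 0 <= u l)%E ->
  (forall e : R, 0 < e -> \forall l \near \oo, (u l <= e%:E)%E) -> u l @[l --> \oo] --> 0%E.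
Proof.
move=> u0 hu; apply/fine_cvgP; split.
  apply: filterS (hu 1 ltr01) => l ul.
  by rewrite ge0_fin_numE// (le_lt_trans ul)// ltry.
apply/cvgrPdist_le => e e0; apply: filterS (hu e e0) => l ul /=.
rewrite sub0r normrN ger0_norm ?fine_ge0// -lee_fin fineK//.
by rewrite ge0_fin_numE// (le_lt_trans ul)// ltry.
Qed.

(** Continuity from above along the tails [\bigcup_(l >= n) B l], whose
    intersection is empty. *)
Lemma vanishing_events_near (B : nat -> set Omega) (e : R) : 0 < e ->
  (forall l, measurable (B l)) -> (forall w, \forall l \near \oo, ~ B l w) ->
  \forall l \near \oo, (P (B l) <= e%:E)%E.
Proof.
move=> e0 mB hB; pose F n := \bigcup_(l in [set l | (n <= l)%N]) B l.
have mF n : measurable (F n) by exact: bigcup_measurable.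
have F0 : \bigcap_n F n = set0.
  apply/seteqP; split => // w hw; have [N _ hN] := hB w.
  by have [l /= Nl Bl] := hw N I; exact: (hN l Nl).
have : (P \o F) n @[n --> \oo] --> 0%E.
  rewrite -(measure0 P) -F0; apply: nonincreasing_cvg_mu => //.
  - by rewrite (le_lt_trans (probability_le1 _ _))// ltry.
  - by rewrite F0.
  - move=> m n mn; apply/subsetPset => w [l /= nl Bl]; exists l => //=.
    exact: leq_trans nl.
move=> /fine_cvgP[_ /cvgrPdist_le/(_ _ e0)]; apply: filterS => n /=.
rewrite sub0r normrN ger0_norm ?fine_ge0// => h.
apply: (@le_trans _ _ (P (F n))).
  by apply: le_measure; rewrite ?inE// => w Bw; exists n => /=.
by rewrite -(@fineK _ (P (F n))) ?lee_fin// fin_num_measure.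
Qed.

(** [A] is tight and [Q l] is eventually small along the indices at which [A l]
    stays bounded. The events [A l <= M] with [Q l > q] are measurable on [D] and
    each outcome in [D] lies in finitely many of them, so [Q l <= q] outside an
    event of small probability. The outer probability that [X l] is large is
    bounded by the probability of an event expressed through [A] and [Q]. *)
Lemma tight_cvg_in_probability0 (X A Q : nat -> Omega -> R) (D : set Omega) (C K : R) :
  measurable D -> P (~` D) = 0%E -> 0 <= C -> 0 < K ->
  (forall l, measurable_fun D (Q l)) -> (forall l, measurable_fun setT (A l)) ->
  (forall l M, 0 < M -> (P [set w | (M <= A l w)%R] <= (C / M)%:E)%E) ->
  (forall l w, D w -> X l w ^+ 2 <= K * Q l w) ->
  (forall w M e, D w -> 0 < M -> 0 < e -> \forall l \near \oo, A l w <= M -> Q l w <= e) ->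
  cvg_in_probability0 P X.
Proof.
move=> mD PD C0 K0 mQ mA tA XQ hQ e e0.
apply: eventually_le_cvg0 => [l|eta eta0].
  exact: mu_ext_ge0.
pose M := 2 * (C + 1) / eta.
have M0 : 0 < M by rewrite divr_gt0// mulr_gt0// ltr_wpDl.
have CM : C / M <= eta / 2.
  rewrite ler_pdivrMr//.
  have -> : eta / 2 * M = C + 1 by rewrite /M; field; rewrite gt_eqF.
  by rewrite lerDl.
pose q := e ^+ 2 / (2 * K).
have q0 : 0 < q by rewrite divr_gt0 ?exprn_gt0// mulr_gt0.
pose B l := D `&` ((A l @^-1` `]-oo, M]) `&` (Q l @^-1` `]q, +oo[)).
have mB l : measurable (B l).
  rewrite /B setIA setIAC; apply: measurableI; last first.
    by rewrite -[X in measurable X]setTI; exact: mA.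
  exact: mQ.
have hB w : \forall l \near \oo, ~ B l w.
  have [Dw|nDw] := EM (D w); last by apply: nearW => l [].
  apply: filterS (hQ w M q Dw M0 q0) => l h [_ [/=]].
  by rewrite !in_itv/= andbT => AM; rewrite ltNge => /negP; apply; exact: h.
have eta2 : 0 < eta / 2 by rewrite divr_gt0.
apply: filterS (vanishing_events_near eta2 mB hB) => l hl.
pose T := ~` D `|` [set w | M <= A l w] `|` B l.
have mAM : measurable [set w | M <= A l w].
  rewrite (_ : [set w | _] = setT `&` A l @^-1` `[M, +oo[%classic); first exact: mA.
  by apply/seteqP; split => w /=; rewrite in_itv/= andbT //; case.
have mDA : measurable (~` D `|` [set w | M <= A l w]).
  by apply: measurableU => //; exact: measurableC.
have mT : measurable T by exact: measurableU.
apply: (@le_trans _ _ (P T)).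
  rewrite -[leRHS]measurable_mu_extE//; apply: le_mu_ext => w /= eX.
  have [Dw|nDw] := EM (D w); last by left; left.
  have [MA|AM] := leP M (A l w); first by left; right.
  right; split => //; split; rewrite /= in_itv/= ?ltW// andbT.
  have := XQ l w Dw; have : e ^+ 2 <= X l w ^+ 2.
    by rewrite -[leRHS]real_normK ?num_real// ler_sqr ?nnegrE// ltW.
  move=> h1 h2; rewrite /q ltr_pdivrMr ?mulr_gt0//.
  by have := exprn_gt0 2 e0; nra.
rewrite (splitr eta) EFinD.
have PU (V W : set Omega) : measurable V -> measurable W -> (P (V `|` W) <= P V + P W)%E.
  by move=> *; exact: measureU2.
apply: (le_trans (PU _ _ mDA (mB l))); apply: leeD => //.
apply: (le_trans (PU _ _ (measurableC mD) mAM)).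
by rewrite PD add0e (le_trans (tA l M M0))// lee_fin.
Qed.

End convergence_in_probability.

Theorem theorem4p1 (R : realType) (s k d : nat) (lambda delta : R)
    (s_ge1 : (1 <= s)%N) (d_ge1 : (1 <= d)%N)
    (lambda_gt0 : 0 < lambda) (delta_gt0 : 0 < delta)
    (disp : measure_display) (Omega : measurableType disp)
    (P : probability Omega R)
    (mudag : tracks R d k) (p : 'I_k.+1 -> R)
    (phi0 : 'rV[R]_d -> R) (phiT : R -> R)
    (phi : nat -> {RV P >-> 'I_k.+1}) (eps : nat -> {RV P >-> 'rV[R]_d})
    (t : nat -> {RV P >-> R}) (y : nat -> {RV P >-> 'rV[R]_d})
    (A1 : assumption1 mudag p phi0 phiT phi eps t y)
    (A2 : assumption2 phi0)
    (A3 : assumption3 phi0)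
    (A4 : assumption4 mudag p phi0)
    (mu : nat -> Omega -> tracks R d k)
    (mu_random : forall n, (0 < n)%N -> random_tracks (mu n))
    (mu_min : forall n, (0 < n)%N ->
      {ae P, forall w,
        minimizes (Theta s delta)
          (f_n s lambda (fun i => t i w) (fun i => y i w) n) (mu n w)})
    (sub : nat -> nat) (sub_incr : {homo sub : l m / (l < m)%N})
    (muoo : Omega -> tracks R d k)
    (mu_weak : {ae P, forall w,
      weak_cvg s (fun m => mu (sub m) w) (muoo w)}) :
  exists sub' : nat -> nat, {homo sub' : l m / (l < m)%N} /\
    cvg_in_probability0 P (fun l w =>
      sobolev_norm s (fun j x => mu (sub (sub' l)) w j x - muoo w j x)).
Proof.
(* Minimality is assumed for positive sample sizes, and [sub 0] may be 0. *)
exists S; split; first by move=> l m; rewrite ltnS.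
have n0 l : (0 < sub l.+1)%N by apply: leq_ltn_trans (sub_incr l l.+1 _).
have [C C0 hC] := second_moment_bounded A1 A2.
have good : {ae P, forall w,
    (forall l, minimizes (Theta s delta)
      (f_n s lambda (fun i => t i w) (fun i => y i w) (sub l.+1)) (mu (sub l.+1) w)) /\
    weak_cvg s (fun l => mu (sub l.+1) w) (muoo w)}.
  have h1 := ae_foralln (fun l => mu_min _ (n0 l)).
  apply: filterS2 h1 mu_weak => w h1 [h2 h3]; split => //; split => // L bL.
  by have := h3 L bL; rewrite -cvg_shiftS.
have [N [mN PN goodN]] := good.
pose D := ~` N; have mD : measurable D by exact: measurableC.
have gD w : D w -> (forall l, minimizes (Theta s delta)
      (f_n s lambda (fun i => t i w) (fun i => y i w) (sub l.+1)) (mu (sub l.+1) w)) /\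
    weak_cvg s (fun l => mu (sub l.+1) w) (muoo w).
  by move=> Dw; apply: contrapT => nw; apply: Dw; exact: goodN.
have sob l w : D w -> sobolev_tracks s (mu (sub l.+1) w).
  by move=> /gD[h _]; exact: (h l).1.1.
have soboo w : D w -> sobolev_tracks s (muoo w) by move=> /gD[_ []].
have rnd l : random_tracks (mu (sub l.+1)) by exact: mu_random.
apply: (@tight_cvg_in_probability0 _ _ _ P _
  (fun l w => mean_sq (fun i => y i w) (sub l.+1))
  (fun l w => \sum_a jet_sqnorm s (track_jet_diff (mu (sub l.+1) w) (muoo w) a))
  D C (s.+1%:R * 4 ^+ s)) => //.
- by rewrite /D setCK; exact: PN.
- move=> l; apply: measurable_sum => a; apply: measurable_jet_sqnorm => //.
    by move=> w Dw; apply: jet_comb; apply: track_jet_jet; [exact: soboo|exact: sob].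
  move=> i x si x01; rewrite /track_jet_diff; apply: measurable_funD; last exact: (measurable_track_jet a (rnd l) (sob l) si x01).
  apply: measurable_funM; first exact: measurable_cst.
  apply: (measurable_track_jet_limit s_ge1 a rnd sob _ si x01).
  by move=> w /gD[].
- by move=> l; exact: measurable_mean_sq.
- by move=> l M M0; exact: mean_sq_tight.
- by move=> l w Dw; apply: sobolev_norm_diff_le => //; [exact: sob|exact: soboo].
- move=> w M e Dw M0 e0; have [hmin hweak] := gD w Dw.
  exact: (minimizers_strong_cvg s_ge1 d_ge1 lambda_gt0 delta_gt0 (fun i => a1_t01 A1 i w) n0 hmin hweak M0 e0).
Qed.
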